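(* Let $t\ge 1$ and let $\mathfrak r$ be a complex solvable Lie algebra with nilradical $\mathfrak n_{2,t}$. Then $\mathfrak r=\mathfrak n_{2,t}\oplus\mathfrak t$ (direct sum of vector spaces), where $\mathfrak t$ is a complex vector space with the same dimension as the projection $\mathfrak p_1(\mathfrak t)=\mathrm{proj}_{\mathrm{Der}_1\,\mathfrak n_{2,t}}(\mathrm{ad}_{\mathfrak n_{2,t}}\mathfrak t)$, which is an abelian subalgebra of $\mathrm{Der}_1\,\mathfrak n_{2,t}$ of dimension at most $2$, and the set of derivations $\mathrm{ad}_{\mathfrak n_{2,t}}\mathfrak t$ contains no nonzero nilpotent elements. Moreover, in case $\mathfrak t=\mathbb C x+\mathbb C y$ is $2$-dimensional, $\mathfrak p_1(\mathfrak t)=C_{\mathrm{Der}_1\,\mathfrak n_{2,t}}(\delta)$ for some $\delta\in\mathrm{Der}_1\,\mathfrak n_{2,t}\setminus\mathbb C\cdot id_{2,t}$, and the bracket derivation $[\mathrm{ad}_{\mathfrak n_{2,t}}x,\mathrm{ad}_{\mathfrak n_{2,t}}y]$ is an inner derivation of $\mathfrak n_{2,t}$.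
   Context: Lie algebras are finite-dimensional over $\mathbb C$ (except the free Lie algebra $\mathfrak{FL}_2$). The nilradical is the largest nilpotent ideal. $\mathfrak n_{2,t}=\mathfrak{FL}_2/\mathfrak{FL}_2^{t+1}$ is the free $t$-nilpotent Lie algebra on two generators $x_1,x_2$: $\mathfrak{FL}_2$ is the free Lie algebra on $x_1,x_2$ and $\mathfrak{FL}_2^{t+1}$ is the ideal spanned by all brackets of length at least $t+1$ in the generators. Put $\mathfrak m=\mathrm{span}\langle x_1,x_2\rangle$ and let $\mathfrak m^k$ be the span of the left-normed brackets of length $k$ in $x_1,x_2$; then $\mathfrak n_{2,t}=\mathfrak m\oplus\mathfrak m^2\oplus\dots\oplus\mathfrak m^t$. Every linear map $\delta:\mathfrak m\to\mathfrak n_{2,t}$ extends uniquely to a derivation $\widehat\delta$ of $\mathfrak n_{2,t}$. Put $\mathrm{Der}_j\,\mathfrak n_{2,t}=\{\widehat\delta:\delta\in\mathrm{Hom}(\mathfrak m,\mathfrak m^j)\}$, so that $\mathrm{Der}\,\mathfrak n_{2,t}=\bigoplus_{j=1}^t\mathrm{Der}_j\,\mathfrak n_{2,t}$, and $\mathrm{proj}_{\mathrm{Der}_1\,\mathfrak n_{2,t}}$ is the projection onto the summand $\mathrm{Der}_1\,\mathfrak n_{2,t}\cong\mathfrak{gl}_2(\mathbb C)$. $id_{2,t}=\widehat{id_{\mathfrak m}}$ is the derivation extending the identity of $\mathfrak m$. For $a\in\mathfrak r$, $\mathrm{ad}_{\mathfrak n_{2,t}}a$ is the derivation $b\mapsto[a,b]$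 of $\mathfrak n_{2,t}$. $C_{L}(\delta)$ is the centralizer of $\delta$ in the Lie algebra $L$. *)

(* Defs.v *)
From HB Require Import structures.
From mathcomp Require Import all_boot all_order all_algebra.
From mathcomp Require Import ssrAC boolp.

Set Implicit Arguments.
Unset Strict Implicit.
Unset Printing Implicit Defensive.

Import GRing.Theory.
Local Open Scope ring_scope.
Local Open Scope quotient_scope.

HB.mixin Record Lmodule_isLie (K : fieldType) (L : Type) of GRing.Lmodule K L := {
  lie : L -> L -> L;
  lie_linearl : forall (a : K) (x y z : L),
    lie (a *: x + y) z = a *: lie x z + lie y z;
  lie_linearr : forall (a : K) (x y z : L),
    lie z (a *: x + y) = a *: lie z x + lie z y;
  liexx : forall x : L, lie x x = 0;
  lie_jacobi : forall x y z : L,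
    lie x (lie y z) + lie y (lie z x) + lie z (lie x y) = 0
}.

#[short(type="lieType")]
HB.structure Definition LieAlg (K : fieldType) :=
  { L of GRing.Lmodule K L & Lmodule_isLie K L }.

#[short(type="vectLieType")]
HB.structure Definition VectLie (K : fieldType) :=
  { L of Vector K L & LieAlg K L }.

Section LieTheory.
Variables (K : fieldType) (L : lieType K).
Implicit Types (a : K) (x y z : L).

Lemma lieDl x y z : lie (x + y) z = lie x z + lie y z.
Proof. by have := lie_linearl 1 x y z; rewrite !scale1r. Qed.
Lemma lieDr x y z : lie z (x + y) = lie z x + lie z y.
Proof. by have := lie_linearr 1 x y z; rewrite !scale1r. Qed.
Lemma lie0l z : lie 0 z = 0.
Proof. by apply: (addrI (lie 0 z)); rewrite -lieDl !addr0. Qed.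
Lemma lie0r z : lie z 0 = 0.
Proof. by apply: (addrI (lie z 0)); rewrite -lieDr !addr0. Qed.
Lemma lieZl a x z : lie (a *: x) z = a *: lie x z.
Proof. by have := lie_linearl a x 0 z; rewrite lie0l !addr0. Qed.
Lemma lieZr a x z : lie z (a *: x) = a *: lie z x.
Proof. by have := lie_linearr a x 0 z; rewrite lie0r !addr0. Qed.
Lemma lieNl x z : lie (- x) z = - lie x z.
Proof. by rewrite -scaleN1r lieZl scaleN1r. Qed.
Lemma lieNr x z : lie z (- x) = - lie z x.
Proof. by rewrite -scaleN1r lieZr scaleN1r. Qed.
Lemma lieC x y : lie x y = - lie y x.
Proof.
have := liexx (x + y); rewrite lieDl !lieDr !liexx add0r addr0.
by move=> h; apply/eqP; rewrite -subr_eq0 opprK h.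
Qed.

End LieTheory.

Definition lie_morph (K : fieldType) (L M : lieType K) (f : L -> M) : Prop :=
  forall x y : L, f (lie x y) = lie (f x) (f y).

Section Gl.
Variables (K : fieldType) (V : vectType K).
Implicit Types f g h : 'End(V).

Definition commutator f g : 'End(V) := (f \o g)%VF - (g \o f)%VF.

Lemma commutatorE f g v : commutator f g v = f (g v) - g (f v).
Proof. by rewrite /commutator add_lfunE opp_lfunE !comp_lfunE. Qed.

Fact commutator_linearl (a : K) f g h :
  commutator (a *: f + g) h = a *: commutator f h + commutator g h.
Proof.
apply/lfunP => v; rewrite !(commutatorE, add_lfunE, scale_lfunE).
by rewrite linearP scalerBr opprD addrACA.
Qed.

Fact commutator_linearr (a : K) f g h :
  commutator h (a *: f + g) = a *: commutator h f + commutator h g.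
Proof.
apply/lfunP => v; rewrite !(commutatorE, add_lfunE, scale_lfunE).
by rewrite linearP scalerBr opprD addrACA.
Qed.

Fact commutatorxx f : commutator f f = 0.
Proof. exact: subrr. Qed.

Fact commutator_jacobi f g h :
  commutator f (commutator g h) + commutator g (commutator h f)
    + commutator h (commutator f g) = 0.
Proof.
have E (a b c d : V) : a - b + (- c - - d) = (a + d) - (b + c).
  by rewrite opprK [- c + d]addrC addrACA -opprD.
apply/lfunP => v; rewrite !(commutatorE, add_lfunE, zero_lfunE) !linearB /= !E.
set a := f (g (h v)); set b := f (h (g v)); set c := g (h (f v)).
set d := g (f (h v)); set e := h (f (g v)); set k := h (g (f v)).
rewrite [c + b]addrC [e + d]addrC [k + a]addrC.
by rewrite [X in X + _]addrA subrK addrA subrK subrr.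
Qed.

HB.instance Definition _ := Lmodule_isLie.Build K 'End(V)
  commutator_linearl commutator_linearr commutatorxx commutator_jacobi.

Definition nilpotent_endo f : Prop :=
  exists k, forall v : V, iter k f v = 0.

End Gl.

Section VectLieTheory.
Variables (K : fieldType) (L : vectLieType K).
Implicit Types (U W N : {vspace L}) (x y : L) (D : 'End(L)).

Fact lier_is_linear x : linear (lie x).
Proof. by move=> a u v; rewrite lie_linearr. Qed.
HB.instance Definition _ x :=
  GRing.isLinear.Build K L L *:%R (lie x) (lier_is_linear x).

Definition ad_elt x : 'End(L) := linfun (lie x).

Lemma ad_eltE x y : ad_elt x y = lie x y.
Proof. by rewrite lfunE. Qed.

Fact ad_elt_is_linear : linear ad_elt.
Proof.
by move=> a x y; apply/lfunP => z;
  rewrite add_lfunE scale_lfunE !ad_eltE lie_linearl.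
Qed.
HB.instance Definition _ :=
  GRing.isLinear.Build K L 'End(L) *:%R ad_elt ad_elt_is_linear.

Definition ad : 'Hom(L, 'End(L)) := linfun ad_elt.

Lemma adE x y : ad x y = lie x y.
Proof. by rewrite lfunE /= ad_eltE. Qed.

(* By bilinearity, brackets of basis vectors span [U, W]; see memv_lie, lie_vsP. *)
Definition lie_vs U W : {vspace L} :=
  <<allpairs lie (vbasis U) (vbasis W)>>%VS.

Lemma memv_lie U W x y : x \in U -> y \in W -> lie x y \in lie_vs U W.
Proof.
move=> /coord_vbasis -> /coord_vbasis ->.
rewrite linear_sum; apply: memv_suml => j _; rewrite linearZ memvZ //= -adE.
rewrite linear_sum sum_lfunE; apply: memv_suml => i _.
rewrite linearZ scale_lfunE memvZ //= adE memv_span //.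
by apply/allpairsP; exists ((vbasis U)`_i, (vbasis W)`_j);
  rewrite !memt_nth.
Qed.

Lemma lie_vsP U W N :
  reflect (forall x y, x \in U -> y \in W -> lie x y \in N)
          (lie_vs U W <= N)%VS.
Proof.
apply: (iffP idP) => [sN x y Ux Wy | h].
  exact: subvP sN _ (memv_lie Ux Wy).
by apply/span_subvP => _ /allpairsP[[x y] /= [Ux Wy ->]];
  apply: h; apply: vbasis_mem.
Qed.

Fixpoint derived_series U k : {vspace L} :=
  if k is k'.+1 then lie_vs (derived_series U k') (derived_series U k') else U.

Fixpoint lower_central_series U k : {vspace L} :=
  if k is k'.+1 then lie_vs U (lower_central_series U k') else U.

Definition is_solvable U : Prop := exists k, derived_series U k = 0%VS.
Definition is_nilpotent U : Prop := exists k, lower_central_series U k = 0%VS.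
Definition is_subalgebra U : Prop := (lie_vs U U <= U)%VS.
Definition is_abelian U : Prop := lie_vs U U = 0%VS.
Definition is_ideal U : Prop := (lie_vs fullv U <= U)%VS.

Definition is_nilradical N : Prop :=
  [/\ is_ideal N, is_nilpotent N
    & forall U, is_ideal U -> is_nilpotent U -> (U <= N)%VS].

Definition centralizer U x : {vspace L} := (U :&: lker (ad x))%VS.

Lemma centralizerP U x y :
  reflect (y \in U /\ lie x y = 0) (y \in centralizer U x).
Proof.
by rewrite memv_cap memv_ker adE; apply: (iffP andP) => -[-> /eqP].
Qed.

Definition is_derivation D : Prop :=
  forall x y, D (lie x y) = lie (D x) y + lie x (D y).

(* D is a derivation iff [D, ad x] = ad (D x) for all x. *)
Definition der_defect D x : 'End(L) := lie D (ad x) - ad (D x).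

Fact der_defect_is_linear D : linear (der_defect D).
Proof.
move=> a x y; rewrite /der_defect [ad (_ + _)]linearP lie_linearr.
by rewrite [D (_ + _)]linearP [ad (_ + _)]linearP opprD addrACA -scalerBr.
Qed.
HB.instance Definition _ D :=
  GRing.isLinear.Build K L 'End(L) *:%R (der_defect D) (der_defect_is_linear D).

Definition der_defect_lfun D : 'Hom(L, 'End(L)) := linfun (der_defect D).

Fact der_defect_lfun_is_linear : linear der_defect_lfun.
Proof.
move=> a D E; apply/lfunP => x; rewrite add_lfunE scale_lfunE !lfunE /=.
rewrite /der_defect lie_linearl add_lfunE scale_lfunE [ad (_ + _)]linearP.
by rewrite opprD addrACA -scalerBr.
Qed.
HB.instance Definition _ :=
  GRing.isLinear.Build K 'End(L) 'Hom(L, 'End(L)) *:%R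
    der_defect_lfun der_defect_lfun_is_linear.

Definition Der : {vspace 'End(L)} := lker (linfun der_defect_lfun).

Lemma DerP D : reflect (is_derivation D) (D \in Der).
Proof.
rewrite memv_ker lfunE /=; apply: (iffP eqP) => [h x y | h].
  have /lfunP/(_ y) := congr1 (fun f : 'Hom(L, 'End(L)) => f x) h.
  rewrite lfunE /= /der_defect add_lfunE opp_lfunE commutatorE !zero_lfunE !adE.
  by move/eqP; rewrite -addrA -opprD subr_eq0 => /eqP ->; rewrite addrC.
apply/lfunP => x; rewrite lfunE /=; apply/lfunP => y.
rewrite /der_defect add_lfunE opp_lfunE commutatorE !zero_lfunE !adE.
by rewrite h addrK subrr.
Qed.

End VectLieTheory.

Section FreeLie.
Variable K : fieldType.

Inductive lie_term : Type :=
| TGen of 'I_2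
| TZero
| TAdd of lie_term & lie_term
| TScale of K & lie_term
| TLie of lie_term & lie_term.

(* FL2 below is the set of terms modulo the congruence generated by the axioms
   of Lie algebras over K; fl_lift and fl_lift_uniq give its universal property. *)
Inductive lie_cong : lie_term -> lie_term -> Prop :=
| lc_refl u : lie_cong u u
| lc_sym u v : lie_cong u v -> lie_cong v u
| lc_trans u v w : lie_cong u v -> lie_cong v w -> lie_cong u w
| lc_add u u' v v' :
    lie_cong u u' -> lie_cong v v' -> lie_cong (TAdd u v) (TAdd u' v')
| lc_scale a u u' : lie_cong u u' -> lie_cong (TScale a u) (TScale a u')
| lc_lie u u' v v' :
    lie_cong u u' -> lie_cong v v' -> lie_cong (TLie u v) (TLie u' v')
| lc_addA u v w : lie_cong (TAdd u (TAdd v w)) (TAdd (TAdd u v) w)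
| lc_addC u v : lie_cong (TAdd u v) (TAdd v u)
| lc_add0 u : lie_cong (TAdd TZero u) u
| lc_addN u : lie_cong (TAdd (TScale (-1) u) u) TZero
| lc_scaleA a b u : lie_cong (TScale a (TScale b u)) (TScale (a * b) u)
| lc_scale1 u : lie_cong (TScale 1 u) u
| lc_scaleDr a u v :
    lie_cong (TScale a (TAdd u v)) (TAdd (TScale a u) (TScale a v))
| lc_scaleDl a b u :
    lie_cong (TScale (a + b) u) (TAdd (TScale a u) (TScale b u))
| lc_linearl a u v w :
    lie_cong (TLie (TAdd (TScale a u) v) w)
             (TAdd (TScale a (TLie u w)) (TLie v w))
| lc_linearr a u v w :
    lie_cong (TLie w (TAdd (TScale a u) v))
             (TAdd (TScale a (TLie w u)) (TLie w v))
| lc_liexx u : lie_cong (TLie u u) TZero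
| lc_jacobi u v w :
    lie_cong (TAdd (TAdd (TLie u (TLie v w)) (TLie v (TLie w u)))
                   (TLie w (TLie u v))) TZero.

HB.instance Definition _ := gen_eqMixin lie_term.
HB.instance Definition _ := gen_choiceMixin lie_term.

Definition lie_congb : rel lie_term := fun u v => `[< lie_cong u v >].

Fact lie_congb_equiv : equiv_class_of lie_congb.
Proof.
split=> [u | u v | v u w].
- by apply/asboolP; apply: lc_refl.
- by apply/asboolP/asboolP; apply: lc_sym.
- by move=> /asboolP uv /asboolP vw; apply/asboolP; apply: lc_trans uv vw.
Qed.
Canonical lie_congb_equivRel := EquivRelPack lie_congb_equiv.
Canonical lie_congb_encModRel := defaultEncModRel lie_congb.

Definition FL2 : Type := {eq_quot lie_congb}.

HB.instance Definition _ := Choice.on FL2.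
HB.instance Definition _ : EqQuotient lie_term lie_congb FL2 := EqQuotient.on FL2.

Definition fl_class (u : lie_term) : FL2 := \pi_FL2 u.

Lemma fl_classP u v : fl_class u = fl_class v <-> lie_cong u v.
Proof.
by split=> [/eqquotP/asboolP | h] //; apply/eqquotP/asboolP.
Qed.

Lemma fl_reprP u : lie_cong (repr (fl_class u)) u.
Proof. by apply/fl_classP; rewrite /fl_class reprK. Qed.

Lemma fl_ind (P : FL2 -> Prop) : (forall u, P (fl_class u)) -> forall x, P x.
Proof. by move=> h x; rewrite -[x]reprK; apply: h. Qed.

Definition fl_gen i : FL2 := fl_class (TGen i).
Definition fl_zero : FL2 := fl_class TZero.
Definition fl_add (x y : FL2) : FL2 := fl_class (TAdd (repr x) (repr y)).
Definition fl_scale (a : K) (x : FL2) : FL2 := fl_class (TScale a (repr x)).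
Definition fl_opp (x : FL2) : FL2 := fl_scale (-1) x.
Definition fl_lie (x y : FL2) : FL2 := fl_class (TLie (repr x) (repr y)).

Lemma fl_classD u v : fl_class (TAdd u v) = fl_add (fl_class u) (fl_class v).
Proof. by apply/fl_classP/lc_sym/lc_add; apply: fl_reprP. Qed.
Lemma fl_classZ a u : fl_class (TScale a u) = fl_scale a (fl_class u).
Proof. by apply/fl_classP/lc_sym/lc_scale; apply: fl_reprP. Qed.
Lemma fl_classL u v : fl_class (TLie u v) = fl_lie (fl_class u) (fl_class v).
Proof. by apply/fl_classP/lc_sym/lc_lie; apply: fl_reprP. Qed.

Let flE := (fl_classD, fl_classZ, fl_classL).

Fact fl_addA : associative fl_add.
Proof.
elim/fl_ind=> u; elim/fl_ind=> v; elim/fl_ind=> w.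
by rewrite -!flE; apply/fl_classP/lc_addA.
Qed.
Fact fl_addC : commutative fl_add.
Proof.
by elim/fl_ind=> u; elim/fl_ind=> v; rewrite -!flE; apply/fl_classP/lc_addC.
Qed.
Fact fl_add0 : left_id fl_zero fl_add.
Proof. by elim/fl_ind=> u; rewrite -!flE; apply/fl_classP/lc_add0. Qed.
Fact fl_addN : left_inverse fl_zero fl_opp fl_add.
Proof. by elim/fl_ind=> u; rewrite /fl_opp -!flE; apply/fl_classP/lc_addN. Qed.
HB.instance Definition _ :=
  GRing.isZmodule.Build FL2 fl_addA fl_addC fl_add0 fl_addN.

Fact fl_scaleA a b x : fl_scale a (fl_scale b x) = fl_scale (a * b) x.
Proof. by elim/fl_ind: x => u; rewrite -!flE; apply/fl_classP/lc_scaleA. Qed.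
Fact fl_scale1 : left_id 1 fl_scale.
Proof. by elim/fl_ind=> u; rewrite -!flE; apply/fl_classP/lc_scale1. Qed.
Fact fl_scaleDr : right_distributive fl_scale +%R.
Proof.
move=> a; elim/fl_ind=> u; elim/fl_ind=> v.
rewrite -[LHS]/(fl_scale a (fl_add _ _)) -[RHS]/(fl_add _ _) -!flE.
exact/fl_classP/lc_scaleDr.
Qed.
Fact fl_scaleDl x : {morph fl_scale^~ x : a b / a + b}.
Proof.
elim/fl_ind: x => u a b; rewrite -[RHS]/(fl_add _ _) -!flE.
exact/fl_classP/lc_scaleDl.
Qed.
HB.instance Definition _ :=
  GRing.Zmodule_isLmodule.Build K FL2 fl_scaleA fl_scale1 fl_scaleDr fl_scaleDl.

Fact fl_linearl (a : K) (x y z : FL2) :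
  fl_lie (a *: x + y) z = a *: fl_lie x z + fl_lie y z.
Proof.
elim/fl_ind: x => u; elim/fl_ind: y => v; elim/fl_ind: z => w.
rewrite -[LHS]/(fl_lie (fl_add (fl_scale _ _) _) _).
rewrite -[RHS]/(fl_add (fl_scale _ _) _) -!flE.
exact/fl_classP/lc_linearl.
Qed.
Fact fl_linearr (a : K) (x y z : FL2) :
  fl_lie z (a *: x + y) = a *: fl_lie z x + fl_lie z y.
Proof.
elim/fl_ind: x => u; elim/fl_ind: y => v; elim/fl_ind: z => w.
rewrite -[LHS]/(fl_lie _ (fl_add (fl_scale _ _) _)).
rewrite -[RHS]/(fl_add (fl_scale _ _) _) -!flE.
exact/fl_classP/lc_linearr.
Qed.
Fact fl_liexx (x : FL2) : fl_lie x x = 0.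
Proof. by elim/fl_ind: x => u; rewrite -flE; apply/fl_classP/lc_liexx. Qed.
Fact fl_jacobi (x y z : FL2) :
  fl_lie x (fl_lie y z) + fl_lie y (fl_lie z x) + fl_lie z (fl_lie x y) = 0.
Proof.
elim/fl_ind: x => u; elim/fl_ind: y => v; elim/fl_ind: z => w.
rewrite -[LHS]/(fl_add (fl_add _ _) _) -!flE.
exact/fl_classP/lc_jacobi.
Qed.
HB.instance Definition _ :=
  Lmodule_isLie.Build K FL2 fl_linearl fl_linearr fl_liexx fl_jacobi.

Section Universal.
Variables (L : lieType K) (g : 'I_2 -> L).

Fixpoint term_eval (u : lie_term) : L :=
  match u with
  | TGen i => g i
  | TZero => 0
  | TAdd u v => term_eval u + term_eval v
  | TScale a u => a *: term_eval u
  | TLie u v => lie (term_eval u) (term_eval v)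
  end.

Lemma term_eval_cong u v : lie_cong u v -> term_eval u = term_eval v.
Proof.
elim=> //= {u v}.
- by move=> u v w _ -> _ ->.
- by move=> u u' v v' _ -> _ ->.
- by move=> a u u' _ ->.
- by move=> u u' v v' _ -> _ ->.
- by move=> u v w; rewrite addrA.
- by move=> u v; rewrite addrC.
- by move=> u; rewrite add0r.
- by move=> u; rewrite scaleN1r addNr.
- by move=> a b u; rewrite scalerA.
- by move=> u; rewrite scale1r.
- by move=> a u v; rewrite scalerDr.
- by move=> a b u; rewrite scalerDl.
- by move=> a u v w; rewrite lie_linearl.
- by move=> a u v w; rewrite lie_linearr.
- by move=> u; rewrite liexx.
- by move=> u v w; rewrite lie_jacobi.
Qed.

Definition fl_lift (x : FL2) : L := term_eval (repr x).

Lemma fl_liftE u : fl_lift (fl_class u) = term_eval u.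
Proof. exact/term_eval_cong/fl_reprP. Qed.

Lemma fl_lift_gen i : fl_lift (fl_gen i) = g i.
Proof. exact: fl_liftE. Qed.

Lemma fl_lift_linear : linear fl_lift.
Proof.
move=> a; elim/fl_ind=> u; elim/fl_ind=> v.
rewrite -[a *: _ + _]/(fl_add (fl_scale _ _) _) -!flE !fl_liftE //.
Qed.

HB.instance Definition _ :=
  GRing.isLinear.Build K FL2 L *:%R fl_lift fl_lift_linear.

Lemma fl_lift_lie : lie_morph fl_lift.
Proof.
elim/fl_ind=> u; elim/fl_ind=> v.
by rewrite -[lie (fl_class _) _]/(fl_lie _ _) -flE !fl_liftE.
Qed.

Lemma fl_lift_uniq (f : FL2 -> L) :
  linear f -> lie_morph f -> (forall i, f (fl_gen i) = g i) -> f =1 fl_lift.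
Proof.
move=> flin flie fg; elim/fl_ind=> u; rewrite fl_liftE.
have f0 : f 0 = 0.
  by have := flin (-1) 0 0; rewrite scaler0 addr0 scaleN1r addNr.
have fD x y : f (x + y) = f x + f y by have := flin 1 x y; rewrite !scale1r.
have fZ a x : f (a *: x) = a *: f x.
  by have := flin a x 0; rewrite f0 !addr0.
elim: u => [i || u IHu v IHv | a u IHu | u IHu v IHv] /=.
- exact: fg.
- exact: f0.
- by rewrite flE -IHu -IHv -fD.
- by rewrite flE -IHu -fZ.
- by rewrite flE -IHu -IHv -flie.
Qed.

End Universal.

Inductive fl_bracket : nat -> FL2 -> Prop :=
| fl_bracket_gen i : fl_bracket 1 (fl_gen i)
| fl_bracket_lie j k x y :
    fl_bracket j x -> fl_bracket k y -> fl_bracket (j + k) (lie x y).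

(* FL2^k, the span of all brackets (with any parenthesization) of length at
   least k in the generators; it is an ideal by fl_pow_ideal. *)
Inductive fl_pow (k : nat) : FL2 -> Prop :=
| fl_pow0 : fl_pow k 0
| fl_pow_cons (a : K) j x y :
    (k <= j)%N -> fl_bracket j x -> fl_pow k y -> fl_pow k (a *: x + y).

Lemma fl_powP k a x y : fl_pow k x -> fl_pow k y -> fl_pow k (a *: x + y).
Proof.
move=> px py; elim: px => [|b j u v kj bu _ IH]; first by rewrite scaler0 add0r.
by rewrite scalerDr -addrA scalerA; apply: fl_pow_cons bu IH.
Qed.

Lemma fl_powD k x y : fl_pow k x -> fl_pow k y -> fl_pow k (x + y).
Proof. by move=> px py; rewrite -[x]scale1r; apply: fl_powP. Qed.

Lemma fl_powZ k a x : fl_pow k x -> fl_pow k (a *: x).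
Proof. by move=> px; rewrite -[_ *: _]addr0; apply: fl_powP (fl_pow0 k). Qed.

Lemma fl_bracket_pow j k x : (k <= j)%N -> fl_bracket j x -> fl_pow k x.
Proof.
move=> kj bx; rewrite -[x]addr0 -[x]scale1r.
exact: fl_pow_cons bx (fl_pow0 k).
Qed.

Lemma fl_pow_lie j k x y : fl_pow j x -> fl_pow k y -> fl_pow (j + k) (lie x y).
Proof.
move=> px py; elim: px => [|a i u v ji bu _ IH].
  by rewrite lie0l; apply: fl_pow0.
rewrite lie_linearl; apply: fl_powP IH.
elim: py => [|b l u' v' kl bu' _ IH']; first by rewrite lie0r; apply: fl_pow0.
rewrite lie_linearr; apply: fl_powP IH'.
by apply: fl_bracket_pow (fl_bracket_lie bu bu'); apply: leq_add.
Qed.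

Lemma fl_powW j k x : (j <= k)%N -> fl_pow k x -> fl_pow j x.
Proof.
move=> jk; elim=> [|a i u v ki bu _ IH]; first exact: fl_pow0.
exact: fl_pow_cons (leq_trans jk ki) bu IH.
Qed.

Lemma fl_pow1 x : fl_pow 1 x.
Proof.
elim/fl_ind: x; elim=> [i || u IHu v IHv | a u IHu | u IHu v IHv].
- exact: fl_bracket_pow (fl_bracket_gen i).
- exact: fl_pow0.
- by rewrite flE; apply: fl_powD.
- by rewrite flE; apply: fl_powZ.
- by rewrite flE; apply: fl_powW (fl_pow_lie IHu IHv).
Qed.

Lemma fl_pow_ideal k x y : fl_pow k y -> fl_pow k (lie x y).
Proof. by move=> py; apply: fl_powW (fl_pow_lie (fl_pow1 x) py). Qed.

End FreeLie.

Section FiniteSpan.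
Variables (K : fieldType) (V : lmodType K).

Definition spanned_by n (s : 'I_n -> V) : Prop :=
  forall v, exists c : 'rV[K]_n, v = \sum_i c 0 i *: s i.

Lemma spanned_by_vector n (s : 'I_n -> V) :
  spanned_by s -> exists d, exists f : V -> 'rV[K]_d, linear f /\ bijective f.
Proof.
move=> sV; have exn : exists n, `[< exists s : 'I_n -> V, spanned_by s >].
  by exists n; apply/asboolP; exists s.
case: (ex_minnP exn) => {n s sV exn} d /asboolP[s sV] min_d; exists d.
pose F (c : 'rV[K]_d) := \sum_i c 0 i *: s i.
have Flin (a : K) (c e : 'rV[K]_d) : F (a *: c + e) = a *: F c + F e.
  rewrite /F scaler_sumr -big_split /=; apply: eq_bigr => i _.
  by rewrite !mxE scalerDl scalerA.
have F0 c : F c = 0 -> c = 0.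
  move=> Fc; apply/rowP => i; rewrite mxE; apply/eqP/negPn/negP => ci.
  case: d => [|d] in s sV min_d F Flin c Fc i ci *; first by case: i ci.
  suff: (d.+1 <= d)%N by rewrite ltnn.
  apply: min_d; apply/asboolP; exists (fun j => s (lift i j)) => v.
  have [e ->] := sV v.
  exists (\row_j (e 0 (lift i j) - e 0 i / c 0 i * c 0 (lift i j))).
  rewrite -/(F e).
  have -> : F e = F (- (e 0 i / c 0 i) *: c + e) by rewrite Flin Fc scaler0 add0r.
  rewrite /F (bigD1_ord i) //= !mxE mulNr divfK // addNr scale0r add0r.
  by apply: eq_bigr => j _; rewrite !mxE mulNr addrC.
have Finj : injective F.
  move=> c e Fce; apply/eqP; rewrite -subr_eq0; apply/eqP/F0.
  by rewrite -[c - e]addrC -scaleN1r Flin Fce scaleN1r addNr.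
have [G FG] := choice sV.
have GK : cancel G F by move=> v; rewrite /F -FG.
exists G; split; last by exists F => // c; apply/Finj/GK.
by move=> a u v; apply: Finj; rewrite GK Flin !GK.
Qed.

End FiniteSpan.

(* The Lie algebra L (x) K[e]/(e^2); (x, x') stands for x + x' e. *)
Section DualLie.
Variables (K : fieldType) (L : lieType K).

Definition dual_lie : Type := (L * L)%type.
HB.instance Definition _ := GRing.Lmodule.on dual_lie.

Definition dual_bracket (x y : dual_lie) : dual_lie :=
  (lie x.1 y.1, lie x.1 y.2 + lie x.2 y.1).

Fact dual_linearl (a : K) (x y z : dual_lie) :
  dual_bracket (a *: x + y) z = a *: dual_bracket x z + dual_bracket y z.
Proof.
congr (_, _); rewrite /= !lie_linearl //.
by rewrite scalerDr addrACA.
Qed.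
Fact dual_linearr (a : K) (x y z : dual_lie) :
  dual_bracket z (a *: x + y) = a *: dual_bracket z x + dual_bracket z y.
Proof.
congr (_, _); rewrite /= !lie_linearr //.
by rewrite scalerDr addrACA.
Qed.
Fact dual_liexx (x : dual_lie) : dual_bracket x x = 0.
Proof. by congr (_, _); rewrite /= ?liexx // [X in _ + X]lieC subrr. Qed.
Fact dual_jacobi (x y z : dual_lie) :
  dual_bracket x (dual_bracket y z) + dual_bracket y (dual_bracket z x)
    + dual_bracket z (dual_bracket x y) = 0.
Proof.
congr (_, _); rewrite /= ?lie_jacobi // !lieDr.
rewrite !addrA [LHS](ACl ((1*5*9)*(2*6*7)*(3*4*8))) /=.
by rewrite !lie_jacobi !addr0.
Qed.
HB.instance Definition _ := Lmodule_isLie.Build K dual_lie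
  dual_linearl dual_linearr dual_liexx dual_jacobi.

End DualLie.
Section FreeNilpotent.
Variables (K : fieldType) (t : nat).

(* n2 is the quotient of FL2 by the ideal FL2^(t+1). *)
Definition fl_powb : {pred FL2 K} := fun x => `[< fl_pow t.+1 x >].

Fact fl_powb_zmod_closed : zmod_closed fl_powb.
Proof.
split=> [|x y /asboolP px /asboolP py]; apply/asboolP; first exact: fl_pow0.
by rewrite addrC -scaleN1r; apply: fl_powP.
Qed.
HB.instance Definition _ :=
  GRing.isZmodClosed.Build (FL2 K) fl_powb fl_powb_zmod_closed.

Definition n2 : Type := {ideal_quot fl_powb}.

HB.instance Definition _ := GRing.Zmodule.on n2.

Definition n2_class (x : FL2 K) : n2 := \pi_({ideal_quot fl_powb}) x.

Lemma n2_classP x y : n2_class x = n2_class y <-> fl_pow t.+1 (x - y).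
Proof.
split=> [/eqP h | h]; last first.
  by apply/eqP; rewrite -Quotient.idealrBE; apply/asboolP.
by apply/asboolP; move: h; rewrite -Quotient.idealrBE.
Qed.

Lemma n2_reprK : cancel (repr : {ideal_quot fl_powb} -> FL2 K) n2_class.
Proof. exact: reprK. Qed.

Lemma n2_ind (P : n2 -> Prop) : (forall x, P (n2_class x)) -> forall u, P u.
Proof. by move=> h u; rewrite -[u]n2_reprK; apply: h. Qed.

Lemma n2_reprP x : fl_pow t.+1 (repr (n2_class x) - x).
Proof. by apply/n2_classP; rewrite n2_reprK. Qed.

Lemma n2_classD x y : n2_class (x + y) = n2_class x + n2_class y.
Proof. exact: (raddfD \pi_({ideal_quot fl_powb})). Qed.

Definition n2_scale (a : K) (u : n2) : n2 := n2_class (a *: repr u).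
Definition n2_lie (u v : n2) : n2 := n2_class (lie (repr u) (repr v)).

Lemma n2_classZ a x : n2_class (a *: x) = n2_scale a (n2_class x).
Proof.
by apply/esym/n2_classP; rewrite -scalerBr; apply: fl_powZ (n2_reprP x).
Qed.

Lemma n2_classL x y : n2_class (lie x y) = n2_lie (n2_class x) (n2_class y).
Proof.
apply/esym/n2_classP; set x' := repr _; set y' := repr _.
rewrite -[lie x' y'](subrK (lie x' y)) -lieNr -lieDr -addrA -lieNl -lieDl.
apply: fl_powD; first exact: fl_pow_ideal (n2_reprP y).
rewrite lieC -scaleN1r; apply/fl_powZ/fl_pow_ideal; exact: n2_reprP x.
Qed.

Let n2E := (n2_classD, n2_classZ, n2_classL).

Fact n2_scaleA a b u : n2_scale a (n2_scale b u) = n2_scale (a * b) u.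
Proof. by elim/n2_ind: u => x; rewrite -!n2E scalerA. Qed.
Fact n2_scale1 : left_id 1 n2_scale.
Proof. by elim/n2_ind=> x; rewrite -!n2E scale1r. Qed.
Fact n2_scaleDr : right_distributive n2_scale +%R.
Proof.
by move=> a; elim/n2_ind=> x; elim/n2_ind=> y; rewrite -!n2E scalerDr.
Qed.
Fact n2_scaleDl u : {morph n2_scale^~ u : a b / a + b}.
Proof. by elim/n2_ind: u => x a b; rewrite -!n2E scalerDl. Qed.
HB.instance Definition _ :=
  GRing.Zmodule_isLmodule.Build K n2 n2_scaleA n2_scale1 n2_scaleDr n2_scaleDl.

Lemma n2_class0 : n2_class 0 = 0.
Proof. by apply: (addrI (n2_class 0)); rewrite -n2_classD !addr0. Qed.

Lemma n2_class_linear : linear n2_class.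
Proof. by move=> a x y; rewrite !n2E. Qed.

Fact n2_linearl (a : K) (u v w : n2) :
  n2_lie (a *: u + v) w = a *: n2_lie u w + n2_lie v w.
Proof.
elim/n2_ind: u => x; elim/n2_ind: v => y; elim/n2_ind: w => z.
by rewrite -n2_class_linear -!n2_classL lie_linearl n2_class_linear.
Qed.
Fact n2_linearr (a : K) (u v w : n2) :
  n2_lie w (a *: u + v) = a *: n2_lie w u + n2_lie w v.
Proof.
elim/n2_ind: u => x; elim/n2_ind: v => y; elim/n2_ind: w => z.
by rewrite -n2_class_linear -!n2_classL lie_linearr n2_class_linear.
Qed.
Fact n2_liexx (u : n2) : n2_lie u u = 0.
Proof.
by elim/n2_ind: u => x; rewrite -n2_classL liexx n2_class0.
Qed.
Fact n2_jacobi (u v w : n2) :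
  n2_lie u (n2_lie v w) + n2_lie v (n2_lie w u) + n2_lie w (n2_lie u v) = 0.
Proof.
elim/n2_ind: u => x; elim/n2_ind: v => y; elim/n2_ind: w => z.
by rewrite -!n2E lie_jacobi n2_class0.
Qed.
HB.instance Definition _ :=
  Lmodule_isLie.Build K n2 n2_linearl n2_linearr n2_liexx n2_jacobi.

Fixpoint n2_gens k : seq n2 :=
  if k is k'.+1 then n2_gens k' ++ allpairs lie (n2_gens k') (n2_gens k')
  else [seq n2_class (fl_gen K i) | i <- enum 'I_2].

Lemma n2_gensW j k u : (j <= k)%N -> u \in n2_gens j -> u \in n2_gens k.
Proof.
elim: k => [|k IHk]; first by rewrite leqn0 => /eqP ->.
rewrite leq_eqVlt => /predU1P[-> //|]; rewrite ltnS => jk uj.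
by rewrite /= mem_cat IHk.
Qed.

Lemma fl_bracket_gt0 k x : @fl_bracket K k x -> (0 < k)%N.
Proof. by elim=> // i j u v _ i0 _ _; rewrite ltn_addr. Qed.

Lemma n2_gensP k j x : fl_bracket j x -> (j <= k.+1)%N -> n2_class x \in n2_gens k.
Proof.
move=> bx; elim: bx k => {j x} [i | i j x y bx IHx by_ IHy] k jk.
  by apply: (@n2_gensW 0) => //=; apply/map_f; rewrite mem_enum.
have i0 := fl_bracket_gt0 bx; have j0 := fl_bracket_gt0 by_.
case: k => [|k] in jk *; first by case: i j i0 j0 jk {bx by_ IHx IHy} => [|[|i]] [|j].
rewrite /= mem_cat n2_classL; apply/orP; right; apply/allpairsP.
exists (n2_class x, n2_class y); split=> //=.
  by apply: IHx; rewrite -ltnS (leq_trans _ jk) // -addn1 leq_add2l.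
by apply: IHy; rewrite -ltnS (leq_trans _ jk) // -add1n leq_add2r.
Qed.

Let gen_fam (i : 'I_(size (n2_gens t))) : n2 := (n2_gens t)`_i.

Lemma n2_spanned : spanned_by gen_fam.
Proof.
elim/n2_ind=> x; elim: (fl_pow1 x) => [|a j {}x y _ bx _ [c IH]].
  by exists 0; rewrite n2_class0 big1 // => i _; rewrite mxE scale0r.
rewrite n2_class_linear IH; have [jt|tj] := leqP j t.+1; last first.
  exists c; have -> : n2_class x = n2_class 0.
    by apply/n2_classP; rewrite subr0; apply: fl_bracket_pow bx; apply: ltnW.
  by rewrite n2_class0 scaler0 add0r.
have xg := n2_gensP bx jt; have xi := xg; rewrite -index_mem in xi.
exists (a *: delta_mx 0 (Ordinal xi) + c).
rewrite (bigD1 (Ordinal xi)) //= [in RHS](bigD1 (Ordinal xi)) //= !mxE !eqxx.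
rewrite mulr1 scalerDl /gen_fam nth_index // -addrA; congr (_ + (_ + _)).
by apply: eq_bigr => i ni; rewrite !mxE (negPf ni) andbF mulr0 add0r.
Qed.

Fact n2_vector : {d : nat & Vector.axiom d n2}.
Proof.
have [d hd] := cid (spanned_by_vector n2_spanned).
by exists d; have [f [flin fbij]] := cid hd; exists f.
Qed.
HB.instance Definition _ :=
  Lmodule_hasFinDim.Build K n2 (projT2 n2_vector).

Definition n2_gen i : n2 := n2_class (fl_gen K i).

Definition left_normed (w : seq 'I_2) : n2 :=
  if w is i :: w' then foldl (fun u j => lie u (n2_gen j)) (n2_gen i) w' else 0.

Definition m : {vspace n2} := <<[seq n2_gen i | i : 'I_2]>>%VS.

Definition m_pow k : {vspace n2} :=
  <<[seq left_normed (val w) | w : k.-tuple 'I_2]>>%VS.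

Lemma memv_gen i : n2_gen i \in m.
Proof. by apply/memv_span/image_f. Qed.

Lemma m_pow1 : m_pow 1 = m.
Proof.
apply/eqP; rewrite eqEsubv; apply/andP; split; apply/span_subvP => u.
  by case/imageP=> -[[|i []]] //= _ _ ->; apply: memv_gen.
by case/imageP=> i _ ->; apply/memv_span/imageP; exists [tuple i].
Qed.

(* der_ext d is the unique derivation extending d : m -> n2, obtained as the
   preimage of d under the restriction Der n2 -> Hom(m, n2), which is bijective
   by der_extP and der_ext_uniq. *)
Definition res_m (D : subvs_of (Der n2)) : 'Hom(subvs_of m, n2) :=
  (vsval D \o linfun vsval)%VF.

Lemma res_mE D u : res_m D u = vsval D (vsval u).
Proof. by rewrite /res_m comp_lfunE lfunE. Qed.

Fact res_m_is_linear : linear res_m.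
Proof.
move=> a D E; apply/lfunP => u.
by rewrite add_lfunE scale_lfunE !res_mE linearP /= add_lfunE scale_lfunE.
Qed.
HB.instance Definition _ :=
  GRing.isLinear.Build K (subvs_of (Der n2)) 'Hom(subvs_of m, n2) *:%R
    res_m res_m_is_linear.

Definition der_ext (d : 'Hom(subvs_of m, n2)) : 'End(n2) :=
  vsval ((linfun res_m)^-1%VF d).

Fact der_ext_is_linear : linear der_ext.
Proof. by move=> a d e; rewrite /der_ext !linearP. Qed.
HB.instance Definition _ :=
  GRing.isLinear.Build K 'Hom(subvs_of m, n2) 'End(n2) *:%R
    der_ext der_ext_is_linear.

Section DerExists.
Variable g : 'I_2 -> n2.

Let F : FL2 K -> dual_lie n2 := 
  fl_lift (fun i => (n2_gen i, g i) : dual_lie n2).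

Let F_fst x : (F x).1 = n2_class x.
Proof.
have E1 := @fl_lift_uniq K n2 n2_gen _ n2_class_linear n2_classL (fun=> erefl).
rewrite E1; apply: (@fl_lift_uniq K n2 n2_gen (fun x => (F x).1)) => //.
- by move=> a u v; rewrite /F fl_lift_linear.
- by move=> u v; rewrite /F fl_lift_lie.
- by move=> i; rewrite /F fl_lift_gen.
Qed.

Let F_bracket k x : fl_bracket k x -> exists2 a, fl_pow k a & (F x).2 = n2_class a.
Proof.
elim=> {k x} [i | j k x y bx [a pa Ea] by_ [b pb Eb]].
  exists (repr (g i)); first exact: fl_pow1.
  by rewrite /F fl_lift_gen n2_reprK.
exists (lie x b + lie a y).
  by apply: fl_powD; apply: fl_pow_lie => //; apply: fl_bracket_pow (leqnn _) _.
by rewrite /F fl_lift_lie /= -/F Ea Eb !F_fst n2_classD !n2_classL.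
Qed.

Let F_pow x : fl_pow t.+1 x -> (F x).2 = 0.
Proof.
elim=> [|a j u v tj bu _ IH].
  by rewrite /F linear0.
rewrite /F fl_lift_linear /= -/F IH addr0.
have [b pb ->] := F_bracket bu.
have -> : n2_class b = n2_class 0.
  by apply/n2_classP; rewrite subr0; apply: fl_powW pb.
by rewrite n2_class0 scaler0.
Qed.

Lemma der_exists : exists2 D : 'End(n2), D \in Der n2 & forall i, D (n2_gen i) = g i.
Proof.
pose D (u : n2) : n2 := (F (repr u)).2.
have DE x : D (n2_class x) = (F x).2.
  apply/eqP; rewrite -subr_eq0; apply/eqP; rewrite -(F_pow (n2_reprP x)).
  by rewrite /F linearB.
have Dlin : linear D.
  move=> a; elim/n2_ind=> x; elim/n2_ind=> y.
  by rewrite -n2_class_linear !DE /F fl_lift_linear.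
pose DL : {linear n2 -> n2} := HB.pack D (GRing.isLinear.Build K n2 n2 _ D Dlin).
exists (linfun DL); last by move=> i; rewrite lfunE /= DE /F fl_lift_gen.
apply/DerP; elim/n2_ind=> x; elim/n2_ind=> y.
rewrite !lfunE /= -[lie (n2_class _) _]n2_classL !DE.
by rewrite /F fl_lift_lie /= -/F !F_fst addrC.
Qed.

End DerExists.

Lemma der_ext_uniq (D E : 'End(n2)) :
  D \in Der n2 -> E \in Der n2 -> {in m, D =1 E} -> D = E.
Proof.
move=> /DerP dD /DerP dE DE; apply/lfunP; elim/n2_ind; elim/fl_ind.
elim=> [i || u IHu v IHv | a u IHu | u IHu v IHv].
- exact/DE/memv_gen.
- by rewrite -/(fl_zero K) -[fl_zero K]/(0 : FL2 K) n2_class0 !linear0.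
- have -> : n2_class (fl_class (TAdd u v))
      = n2_class (fl_class u) + n2_class (fl_class v).
    by rewrite fl_classD; apply: n2_classD.
  by rewrite !linearD /= IHu IHv.
- have -> : n2_class (fl_class (TScale a u)) = a *: n2_class (fl_class u).
    by rewrite fl_classZ; apply: n2_classZ.
  by rewrite !linearZ /= IHu.
- have -> : n2_class (fl_class (TLie u v))
      = lie (n2_class (fl_class u)) (n2_class (fl_class v)).
    by rewrite fl_classL; apply: n2_classL.
  by rewrite dD dE IHu IHv.
Qed.

Lemma der_extP (d : 'Hom(subvs_of m, n2)) :
  der_ext d \in Der n2 /\ forall u : subvs_of m, der_ext d (vsval u) = d u.
Proof.
split; first exact: subvsP.
have [D dD Dg] := der_exists (fun i => d (vsproj m (n2_gen i))).
have Dd : linfun res_m (Subvs dD) = d.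
  suff mE : (m <= lker (D - (d \o linfun (vsproj m))%VF))%VS.
    apply/lfunP => u; rewrite lfunE /= res_mE /=; apply/eqP.
    have := subvP mE _ (subvsP u); rewrite memv_ker add_lfunE opp_lfunE.
    by rewrite comp_lfunE lfunE /= vsvalK subr_eq0.
  apply/span_subvP => _ /imageP[i _ ->].
  by rewrite memv_ker add_lfunE opp_lfunE comp_lfunE lfunE /= Dg subrr.
have res_im : d \in limg (linfun res_m) by rewrite -Dd memv_img ?memvf.
by move=> u; rewrite -res_mE -[res_m _](lfunE res_m) limg_lfunVK.
Qed.

Definition hom_ext j (d : 'Hom(subvs_of m, subvs_of (m_pow j))) : 'End(n2) :=
  der_ext (linfun vsval \o d)%VF.

Fact hom_ext_is_linear j : linear (@hom_ext j).
Proof.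
move=> a d e; rewrite /hom_ext -linearP; congr der_ext; apply/lfunP => u.
by rewrite !(comp_lfunE, add_lfunE, scale_lfunE) linearP.
Qed.
HB.instance Definition _ j :=
  GRing.isLinear.Build K 'Hom(subvs_of m, subvs_of (m_pow j)) 'End(n2) *:%R
    (@hom_ext j) (@hom_ext_is_linear j).

Definition Der_ j : {vspace 'End(n2)} := limg (linfun (@hom_ext j)).

Lemma Der_P j D :
  reflect (D \in Der n2 /\ {in m, forall u, D u \in m_pow j}) (D \in Der_ j).
Proof.
apply: (iffP idP) => [/memv_imgP[d _ ->] | [dD Dm]].
  rewrite lfunE /=; have [h1 h2] := der_extP (linfun vsval \o d)%VF.
  split=> // u um; rewrite -[u](vsprojK um) h2 comp_lfunE lfunE; exact: subvsP.
apply/memv_imgP; exists (linfun (vsproj (m_pow j)) \o (D \o linfun vsval))%VF.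
  exact: memvf.
rewrite lfunE /=; have [h1 h2] := der_extP
  (linfun vsval \o (linfun (vsproj (m_pow j)) \o (D \o linfun vsval)))%VF.
apply: der_ext_uniq => // u um; rewrite -[u](vsprojK um) h2 !comp_lfunE !lfunE /=.
by rewrite !vsprojK ?Dm ?subvsP.
Qed.

Definition id2 : 'End(n2) := der_ext (linfun vsval).

Definition proj_Der1 : 'End('End(n2)) :=
  daddv_pi (Der_ 1) (\sum_(2 <= j < t.+1) Der_ j)%VS.

(* When iota is an isomorphism of n2 onto an ideal of r, ad_n2 a is the
   restriction of ad a to this ideal, transported to n2; see ad_n2E. *)
Section AdN2.
Variables (r : vectLieType K) (iota : 'Hom(n2, r)).

Definition ad_n2_elt (a : r) : 'End(n2) := (iota^-1 \o (ad r a \o iota))%VF.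

Fact ad_n2_elt_is_linear : linear ad_n2_elt.
Proof.
move=> c a b; apply/lfunP => u.
by rewrite !(add_lfunE, scale_lfunE, comp_lfunE) !adE lie_linearl linearP.
Qed.
HB.instance Definition _ :=
  GRing.isLinear.Build K r 'End(n2) *:%R ad_n2_elt ad_n2_elt_is_linear.

Definition ad_n2 : 'Hom(r, 'End(n2)) := linfun ad_n2_elt.

Lemma ad_n2E a u : is_ideal (limg iota) -> iota (ad_n2 a u) = lie a (iota u).
Proof.
move=> /lie_vsP idl; rewrite lfunE /= !comp_lfunE adE limg_lfunVK //.
by apply: idl; rewrite ?memvf ?memv_img ?memvf.
Qed.

End AdN2.

End FreeNilpotent.

(* Main.v *)
From HB Require Import structures.
Require Import Defs.
From mathcomp Require Import all_boot all_order all_algebra.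
From mathcomp Require Import ssrAC ring zify.
From mathcomp Require Import reals.
From mathcomp.real_closed Require Import complex.
From mathcomp Require boolp.

(** Write N for the nilradical and consider the action of r on the plane
    N / [N, N], given by 2 x 2 matrices. N acts by zero.

    The main point is that an ideal [A] of r with [A, A] contained in N, acting
    on the plane by matrices whose pairwise products vanish, is nilpotent
    ([nil_action_sub]): N carries a filtration, vanishing in large degree, that
    is shifted by every element of [A]. Maximality of N then puts [A] in N. This
    is used twice. First, if [r, r] were not contained in N, it would apply to the
    last term of the derived series outside N, by elementary facts on commuting
    2 x 2 matrices; hence [r, r] is contained in N ([derived_sub_nilradical]) and
    r acts on the plane by commuting matrices. Second, it applies to the sum of N
    and the line of an element acting nilpotently on the plane: such an element
    lies in N ([rho_sqr0_mem_N]), so a complement T of N acts faithfully on the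
    plane, and no nonzero element of T acts nilpotently.

    A derivation of n2 is a sum of components in the spaces [Der_ j]; those with
    [j >= 2] act by zero on the plane, while the one in [Der_ 1] is determined by
    its matrix there. Hence the projection of ad T to [Der_ 1] is an isomorphic
    copy of the action of T on the plane, and the remaining claims are facts on abelian subalgebras of gl_2: the
    centralizer of a non-scalar matrix is the plane spanned by it and the
    identity ([comm_mx2_span]). The bracket of ad x and ad y is inner because
    [x, y] lies in N.

    The argument works over every field of characteristic different from 2. The
    parameter of n2 is written [t.+1] before the final statement, because
    N / [N, N] is a plane only when that parameter is positive. *)

Set Implicit Arguments.
Unset Strict Implicit.
Unset Printing Implicit Defensive.

Import GRing.Theory.
Local Open Scope ring_scope.

(** * Two by two matrices *)

Section Matrices2.
Variable K : fieldType.
Implicit Types A B C X Y : 'M[K]_2.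

Lemma mx2P A B :
  A 0 0 = B 0 0 -> A 0 1 = B 0 1 -> A 1 0 = B 1 0 -> A 1 1 = B 1 1 -> A = B.
Proof.
have I2 (i : 'I_2) : i = 0 \/ i = 1.
  by case: i => [[|[|//]] hi]; [left | right]; apply: val_inj.
by move=> *; apply/matrixP => i j; case: (I2 i) => ->; case: (I2 j) => ->.
Qed.

Lemma mulmx2E A B i j : (A *m B) i j = A i 0 * B 0 j + A i 1 * B 1 j.
Proof.
rewrite mxE !big_ord_recl big_ord0 addr0.
by rewrite (_ : lift ord0 ord0 = 1) //; apply: val_inj.
Qed.

Lemma trace2E A : \tr A = A 0 0 + A 1 1.
Proof.
rewrite /mxtrace !big_ord_recl big_ord0 addr0.
by rewrite (_ : lift ord0 ord0 = 1) //; apply: val_inj.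
Qed.

(** The centralizer of a non-scalar 2 x 2 matrix [A] is spanned by [1] and [A]:
    the entries of [B] off the scalars are proportional to those of [A]. *)
Lemma comm_mx2_span A B : ~~ is_scalar_mx A -> A *m B = B *m A ->
  exists a b, B = a%:M + b *: A.
Proof.
move=> nsA /matrixP AB.
have h00 := AB 0 0; have h01 := AB 0 1; have h10 := AB 1 0.
rewrite !mulmx2E in h00 h01 h10.
(* It suffices to find the ratio [b]; it is read off a nonzero entry of A among
   A 0 1, A 1 0 and A 0 0 - A 1 1. *)
have H b : B 0 1 = b * A 0 1 -> B 1 0 = b * A 1 0 ->
    B 0 0 - B 1 1 = b * (A 0 0 - A 1 1) -> exists a b, B = a%:M + b *: A.
  move=> e01 e10 e; exists (B 0 0 - b * A 0 0), b.
  apply: mx2P; rewrite !mxE /= ?mulr1n ?mulr0n ?add0r //; first by ring.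
  have -> : B 1 1 = B 0 0 - (B 0 0 - B 1 1) by ring.
  by rewrite e; ring.
have [b0|b0] := eqVneq (A 0 1) 0; last first.
  apply: (H (B 0 1 / A 0 1)); first by field.
    apply: (mulfI b0); transitivity (B 0 1 * A 1 0); last by field.
    by apply: (addrI (A 0 0 * B 0 0)); rewrite h00; ring.
  apply: (mulfI b0); transitivity (B 0 1 * (A 0 0 - A 1 1)); last by field.
  transitivity (B 0 0 * A 0 1 + B 0 1 * A 1 1 - A 0 1 * B 1 1 - B 0 1 * A 1 1); first by ring.
  by rewrite -h01; ring.
have [c0|c0] := eqVneq (A 1 0) 0; last first.
  apply: (H (B 1 0 / A 1 0)); last 2 first.
  - by field.
  - apply: (mulfI c0); transitivity (B 1 0 * (A 0 0 - A 1 1)); last by field.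
    transitivity (A 1 0 * B 0 0 + A 1 1 * B 1 0 - B 1 1 * A 1 0 - A 1 1 * B 1 0); first by ring.
    by rewrite h10; ring.
  apply: (mulfI c0); transitivity (A 0 1 * B 1 0); last by field.
  by apply: (addrI (A 0 0 * B 0 0)); rewrite h00; ring.
have [d0|d0] := eqVneq (A 0 0 - A 1 1) 0.
  case/negP: nsA; apply/is_scalar_mxP; exists (A 0 0).
  apply: mx2P; rewrite !mxE /= ?mulr1n ?mulr0n //.
  by apply/esym/eqP; rewrite -subr_eq0 d0.
apply: (H ((B 0 0 - B 1 1) / (A 0 0 - A 1 1))); last by field.
- apply: (mulfI d0); rewrite b0 !mulr0.
  by rewrite b0 in h01; transitivity (A 0 0 * B 0 1 + 0 * B 1 1 - B 0 1 * A 1 1); [ring|rewrite h01; ring].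
- apply: (mulfI d0); rewrite c0 !mulr0.
  by rewrite c0 in h10; transitivity (B 1 0 * A 0 0 + B 1 1 * 0 - A 1 1 * B 1 0); [ring|rewrite -h10; ring].
Qed.

Lemma trace0_mulmx2 A : \tr A = 0 -> exists d, A *m A = d%:M.
Proof.
rewrite trace2E => /eqP; rewrite addr_eq0 => /eqP h.
exists (A 1 1 * A 1 1 + A 0 1 * A 1 0).
by apply: mx2P; rewrite mulmx2E mxE /= ?mulr1n ?mulr0n ?h; ring.
Qed.

(** By Cayley-Hamilton, [A ^ 2 = s A - d] with [s] the trace and [d] the
    determinant; nilpotency forces first [d = 0], then [s A = 0]. *)
Lemma nilpotent_mx2 A k : A ^+ k = 0 -> A *m A = 0.
Proof.
move=> Ak0; set d := A 0 0 * A 1 1 - A 0 1 * A 1 0; set s := A 0 0 + A 1 1.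
(* [B] is the adjugate of [A], so [A * B = d]. *)
pose B : 'M[K]_2 := s%:M - A.
have CH : A *m A = s *: A - d%:M.
  by apply: mx2P; rewrite mulmx2E !mxE /= ?mulr1n ?mulr0n /d /s; ring.
have d0 : d = 0.
  have AB : A *m B = d%:M.
    by rewrite /B mulmxBr CH mul_mx_scalar opprB addrC subrK.
  have BA : B *m A = d%:M.
    by rewrite /B mulmxBl CH mul_scalar_mx opprB addrC subrK.
  have : (A * B) ^+ k = 0.
    rewrite exprMn_comm ?Ak0 ?mul0r //.
    by rewrite /GRing.comm -[A * B]/(A *m B) -[B * A]/(B *m A) AB BA.
  rewrite -[A * B]/(A *m B) AB -rmorphXn /= => /matrixP/(_ 0 0).
  by rewrite !mxE /= mulr1n => /eqP; rewrite expf_eq0 => /andP[_ /eqP].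
rewrite {}d0 raddf0 subr0 in CH.
have pow j : A ^+ j.+1 = s ^+ j *: A.
  elim: j => [|j IH]; first by rewrite expr1 expr0 scale1r.
  by rewrite exprS IH -scalerAr -[A * A]/(A *m A) CH scalerA exprSr.
have : A ^+ k.+1 = 0 by rewrite exprS Ak0 mulr0.
rewrite pow => /eqP; rewrite scaler_eq0 expf_eq0 => /orP[/andP[_ /eqP s0]|/eqP ->].
  by rewrite CH s0 scale0r.
by rewrite mul0mx.
Qed.

Lemma commuting_sqr0_mx2 A B :
  A *m A = 0 -> B *m B = 0 -> A *m B = B *m A -> A *m B = 0.
Proof.
move=> A2 B2 AB; have [/is_scalar_mxP[a Ea]|nsA] := boolP (is_scalar_mx A).
  move: A2; rewrite {}Ea -scalar_mxM => /matrixP/(_ 0 0).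
  rewrite !mxE mulr1n => /eqP; rewrite mulf_eq0 orbb => /eqP ->.
  by rewrite raddf0 mul0mx.
have [a [b EB]] := comm_mx2_span nsA AB.
have E : A *m B = a *: A by rewrite EB mulmxDr mul_mx_scalar -scalemxAr A2 scaler0 addr0.
have : a *: (a *: A) = 0.
  by rewrite -E scalemxAl -E -mulmxA B2 mulmx0.
rewrite scalerA => /eqP; rewrite scaler_eq0 mulf_eq0 orbb E.
by move=> /orP[] /eqP ->; rewrite ?scale0r ?scaler0.
Qed.

Hypothesis two_neq0 : (2%:R : K) != 0.

(** If [A] squares to a nonzero scalar, then [C = AX - XA] anticommutes with
    [A]; if [C] commutes with [A] as well, then [2 A C = 0], so [C = 0]. *)
Lemma comm_commutator_mx2 A X d :
  A *m A = d%:M -> d != 0 ->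
  A *m (A *m X - X *m A) = (A *m X - X *m A) *m A -> A *m X = X *m A.
Proof.
move=> A2 d0; set C := _ - _ => AC.
have ACC : A *m C + C *m A = 0.
  rewrite /C mulmxBr mulmxBl !mulmxA A2 -!mulmxA A2 mul_scalar_mx mul_mx_scalar.
  by rewrite addrA subrK subrr.
have AC0 : A *m C = 0.
  move: ACC; rewrite -AC -mulr2n -scaler_nat => /eqP.
  by rewrite scaler_eq0 (negPf two_neq0) => /eqP.
have : d *: C = 0 by rewrite -mul_scalar_mx -A2 -mulmxA AC0 mulmx0.
move=> /eqP; rewrite scaler_eq0 (negPf d0) subr_eq0.
by move/eqP.
Qed.

Lemma trace0_nonscalar A d :
  \tr A = 0 -> A *m A = d%:M -> d != 0 -> ~~ is_scalar_mx A.
Proof.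
move=> trA A2 d0; apply/is_scalar_mxP => -[a EA].
move: trA; rewrite EA mxtrace_scalar -mulr_natr => /eqP.
rewrite mulf_eq0 (negPf two_neq0) orbF => /eqP a0.
move: A2 d0; rewrite EA a0 raddf0 mul0mx => /matrixP/(_ 0 0).
by rewrite !mxE mulr1n => <-; rewrite eqxx.
Qed.

Lemma comm_mx2_trans A X Y : ~~ is_scalar_mx A ->
  A *m X = X *m A -> A *m Y = Y *m A -> X *m Y = Y *m X.
Proof.
move=> nsA AX AY; have [a [b ->]] := comm_mx2_span nsA AX.
by rewrite mulmxDl mulmxDr mul_scalar_mx mul_mx_scalar -scalemxAl -scalemxAr AY.
Qed.

End Matrices2.

(** * Spans, brackets and derivations *)

(** A predicate stable under linear combinations holds on a span as soon as it
    holds on the generators. *)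
Lemma span_ind (K : fieldType) (V : vectType K) (P : V -> Prop) (X : seq V) :
  P 0 -> (forall a u v, P u -> P v -> P (a *: u + v)) ->
  {in X, forall x, P x} -> {in <<X>>%VS, forall v, P v}.
Proof.
move=> P0 Plin PX v /(@coord_span _ _ _ (in_tuple X)) ->.
elim/big_ind: _ => // [u w Pu Pw | i _]; first by rewrite -[u]scale1r; apply: Plin.
by rewrite -[_ *: _]addr0; apply: Plin => //; apply: PX; apply: mem_nth.
Qed.

Lemma lie_vs_ind (K : fieldType) (L : vectLieType K) (P : L -> Prop)
    (U W : {vspace L}) :
  P 0 -> (forall a u v, P u -> P v -> P (a *: u + v)) ->
  (forall x y, x \in U -> y \in W -> P (lie x y)) ->
  {in lie_vs U W, forall v, P v}.
Proof.
move=> P0 Plin PUW; apply: span_ind => // _ /allpairsP[[x y] /= [Ux Wy ->]].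
by apply: PUW; apply: vbasis_mem.
Qed.

Lemma lie_leibniz (K : fieldType) (L : lieType K) (x y z : L) :
  lie x (lie y z) = lie (lie x y) z + lie y (lie x z).
Proof.
have /eqP := lie_jacobi x y z; rewrite addr_eq0 -lieC => /eqP <-.
by rewrite [lie z x]lieC lieNr subrK.
Qed.

Lemma derivation_lie (K : fieldType) (L : vectLieType K) (D E : 'End(L)) :
  is_derivation D -> is_derivation E -> is_derivation (lie D E).
Proof.
move=> dD dE x y; rewrite !commutatorE dE dD !linearD /= !dD !dE.
rewrite lieDl !lieNl !lieNr !opprD !addrA -[RHS]addrA.
rewrite [LHS](ACl ((1*5)*(4*8)*(2*7)*(3*6))) /=.
by rewrite !subrr !addr0.
Qed.

Lemma derived_series_ideal (K : fieldType) (r : vectLieType K) k : is_ideal (derived_series (fullv : {vspace r}) k).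
Proof.
elim: k => [|k IH]; first exact: subvf.
apply/lie_vsP => z u _; move: u; apply: lie_vs_ind => [|c u v Hu Hv|x y Hx Hy].
- by rewrite lie0r mem0v.
- by rewrite lie_linearr memvD ?memvZ.
- rewrite lie_leibniz memvD // memv_lie //.
    exact: (lie_vsP _ _ _ IH) (memvf z) Hx.
  exact: (lie_vsP _ _ _ IH) (memvf z) Hy.
Qed.

Lemma derived_series_sub1 (K : fieldType) (r : vectLieType K) k :
  (derived_series (fullv : {vspace r}) k.+1 <= lie_vs fullv fullv)%VS.
Proof. by apply/lie_vsP => x y _ _; apply: memv_lie; apply: memvf. Qed.

(** * The abelianization of the free nilpotent Lie algebra *)

Section AbelianPlane.
Variable K : fieldType.

(** The two-dimensional abelian Lie algebra. *)
Definition abelian_plane : Type := 'rV[K]_2.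
HB.instance Definition _ := GRing.Lmodule.on abelian_plane.

Definition plane_bracket (x y : abelian_plane) : abelian_plane := 0.

Fact plane_linearl (a : K) (x y z : abelian_plane) :
  plane_bracket (a *: x + y) z = a *: plane_bracket x z + plane_bracket y z.
Proof. by rewrite /plane_bracket scaler0 addr0. Qed.
Fact plane_linearr (a : K) (x y z : abelian_plane) :
  plane_bracket z (a *: x + y) = a *: plane_bracket z x + plane_bracket z y.
Proof. by rewrite /plane_bracket scaler0 addr0. Qed.
Fact plane_xx (x : abelian_plane) : plane_bracket x x = 0.
Proof. by []. Qed.
Fact plane_jacobi (x y z : abelian_plane) :
  plane_bracket x (plane_bracket y z) + plane_bracket y (plane_bracket z x)
    + plane_bracket z (plane_bracket x y) = 0.
Proof. by rewrite /plane_bracket !addr0. Qed.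
HB.instance Definition _ := Lmodule_isLie.Build K abelian_plane
  plane_linearl plane_linearr plane_xx plane_jacobi.

End AbelianPlane.

Section Abelianization.
Variables (K : fieldType) (t : nat).

Notation n2 := (n2 K t.+1).
Notation gen := (n2_gen K t.+1).
Notation cls := (@n2_class K t.+1).

(** Induction on Lie expressions in the two generators. *)
Lemma n2_gen_ind (P : n2 -> Prop) :
  (forall i, P (gen i)) -> P 0 -> (forall a u v, P u -> P v -> P (a *: u + v)) ->
  (forall u v, P u -> P v -> P (lie u v)) -> forall u, P u.
Proof.
move=> Pg P0 Plin Plie; elim/n2_ind; elim/fl_ind.
elim=> [i || u IHu v IHv | a u IHu | u IHu v IHv].
- exact: Pg.
- by rewrite -/(fl_zero K) -[fl_zero K]/(0 : FL2 K) n2_class0.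
- rewrite fl_classD -[fl_add _ _]/(fl_class u + fl_class v).
  by rewrite n2_classD -[cls (fl_class u)]scale1r; apply: Plin.
- rewrite fl_classZ -[fl_scale _ _]/(a *: fl_class u).
  by rewrite n2_classZ -[n2_scale _ _]/(a *: cls _) -[_ *: _]addr0; apply: Plin.
- rewrite fl_classL -[fl_lie _ _]/(lie (fl_class u) (fl_class v)).
  by rewrite n2_classL -[n2_lie _ _]/(lie (cls _) (cls _)); apply: Plie.
Qed.

(** The coordinates of an element of the free Lie algebra modulo brackets: the
    Lie morphism onto the abelian plane sending the generators to the canonical
    basis. *)
Definition fl_coord (x : FL2 K) : abelian_plane K :=
  fl_lift (fun i => delta_mx 0 i : abelian_plane K) x.

Lemma fl_coord_bracket k x : fl_bracket k x -> (1 < k)%N -> fl_coord x = 0.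
Proof. by case=> // i j u v _ _ _; rewrite /fl_coord fl_lift_lie. Qed.

Lemma fl_coord_pow k x : fl_pow k x -> (1 < k)%N -> fl_coord x = 0.
Proof.
move=> px k1; elim: px => [|a j u v kj bu _ IH]; first exact: linear0.
rewrite /fl_coord fl_lift_linear -!/(fl_coord _) IH addr0.
by rewrite (fl_coord_bracket bu) ?scaler0 // (leq_trans k1).
Qed.

(** The same coordinates on n2, that is, those of the class of [u] in
    n2 / [n2, n2]. They do not depend on the representative, by [coord1_class]:
    two representatives differ by brackets of length at least [t.+2 >= 2]. *)
Definition coord1 (u : n2) : 'rV[K]_2 := fl_coord (repr u).

Lemma coord1_class x : coord1 (cls x) = fl_coord x.
Proof.
apply/eqP; rewrite -subr_eq0; apply/eqP.
have <- : fl_coord (repr (cls x) - x) = coord1 (cls x) - fl_coord x.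
  exact: linearB.
exact: fl_coord_pow (n2_reprP t.+1 x) isT.
Qed.

Fact coord1_is_linear : linear coord1.
Proof.
move=> a; elim/n2_ind=> x; elim/n2_ind=> y.
by rewrite -n2_class_linear !coord1_class /fl_coord fl_lift_linear.
Qed.
HB.instance Definition _ :=
  GRing.isLinear.Build K n2 'rV[K]_2 *:%R coord1 coord1_is_linear.

Lemma coord1_gen i : coord1 (gen i) = delta_mx 0 i.
Proof. by rewrite coord1_class /fl_coord fl_lift_gen. Qed.

Lemma coord1_lie u v : coord1 (lie u v) = 0.
Proof.
elim/n2_ind: u => x; elim/n2_ind: v => y.
by rewrite -[lie (cls x) _]n2_classL coord1_class /fl_coord fl_lift_lie.
Qed.

Lemma memv_m_coord1 : {in m K t.+1, forall u, u = \sum_i coord1 u 0 i *: gen i}.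
Proof.
apply: span_ind => [|a u v IHu IHv|_ /imageP[i _ ->]].
- by rewrite linear0 big1 // => i _; rewrite mxE scale0r.
- rewrite linearP {1}IHu {1}IHv scaler_sumr -big_split /=; apply: eq_bigr => i _.
  by rewrite !mxE scalerDl scalerA.
- rewrite coord1_gen (bigD1 i) //= mxE !eqxx scale1r big1 ?addr0 // => j ji.
  by rewrite mxE (negPf ji) andbF scale0r.
Qed.

(** The matrix of the map that a derivation induces on n2 / [n2, n2]. It acts on
    row vectors, so [ab_mx] reverses products. *)
Definition ab_mx (D : 'End(n2)) : 'M[K]_2 := \matrix_(i, j) coord1 (D (gen i)) 0 j.

Fact ab_mx_is_linear : linear ab_mx.
Proof.
move=> a D E; apply/matrixP => i j.
by rewrite !mxE add_lfunE scale_lfunE linearP !mxE.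
Qed.
HB.instance Definition _ :=
  GRing.isLinear.Build K 'End(n2) 'M[K]_2 *:%R ab_mx ab_mx_is_linear.

Lemma row_ab_mx i D : row i (ab_mx D) = coord1 (D (gen i)).
Proof. by apply/rowP => j; rewrite !mxE. Qed.

Lemma coord1_der D u : is_derivation D -> coord1 (D u) = coord1 u *m ab_mx D.
Proof.
move=> dD; elim/n2_gen_ind: u => [i || a u v IHu IHv | u v _ _].
- by rewrite coord1_gen -rowE row_ab_mx.
- by rewrite !linear0 mul0mx.
- by rewrite !linearP /= IHu IHv mulmxDl scalemxAl.
- by rewrite dD linearD /= !coord1_lie addr0 mul0mx.
Qed.

Lemma ab_mx_comp D E : is_derivation D -> ab_mx (D \o E)%VF = ab_mx E *m ab_mx D.
Proof.
move=> dD; apply/row_matrixP => i.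
by rewrite row_ab_mx comp_lfunE coord1_der // -row_ab_mx row_mul.
Qed.

Lemma ab_mx_lie D E : is_derivation D -> is_derivation E ->
  ab_mx (lie D E) = ab_mx E *m ab_mx D - ab_mx D *m ab_mx E.
Proof. by move=> dD dE; rewrite linearB /= !ab_mx_comp. Qed.

Lemma ab_mx_nilpotent D : is_derivation D -> nilpotent_endo D ->
  ab_mx D *m ab_mx D = 0.
Proof.
move=> dD [k Dk]; apply: (@nilpotent_mx2 _ _ k).
have H u : coord1 (iter k D u) = coord1 u *m ab_mx D ^+ k.
  elim: k {Dk} => [|k IH] /=; first by rewrite expr0 mulmx1.
  by rewrite coord1_der // IH exprSr mulmxA.
apply/row_matrixP => i; rewrite rowE -coord1_gen -H Dk.
by rewrite linear0 row0.
Qed.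

Lemma ab_mx_ad u : ab_mx (ad n2 u) = 0.
Proof. by apply/row_matrixP => i; rewrite row_ab_mx adE coord1_lie row0. Qed.

End Abelianization.

(** * Degrees of derivations *)

Section Grading.
Variables (K : fieldType) (t : nat).

Notation n2 := (n2 K t.+1).
Notation gen := (n2_gen K t.+1).
Notation cls := (@n2_class K t.+1).
Notation m := (m K t.+1).
Notation m_pow := (m_pow K t.+1).
Notation Der_ := (Der_ K t.+1).

Lemma m_pow_lie_gen k u i : u \in m_pow k -> lie u (gen i) \in m_pow k.+1.
Proof.
move: u; apply: span_ind => [|a u v IHu IHv|_ /imageP[w _ ->]].
- by rewrite lie0l mem0v.
- by rewrite lie_linearl memvD ?memvZ.
- case: w => -[|j w] sw; first by rewrite /= lie0l mem0v.
  have sw' : size (rcons (j :: w) i) == k.+1 by rewrite size_rcons.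
  by apply/memv_span/imageP; exists (Tuple sw') => //=; rewrite foldl_rcons.
Qed.

(** Left-normed brackets span all brackets: by the Jacobi identity,
    the bracket of u with (v, x_i) is ((u, v), x_i) - ((u, x_i), v), and v is a
    shorter bracket than (v, x_i). *)
Lemma m_pow_lie j k u v : u \in m_pow j -> v \in m_pow k ->
  lie u v \in m_pow (j + k).
Proof.
move=> uj vk; move: v vk u uj.
apply: span_ind => [u _ | a v w IHv IHw u uj | _ /imageP[w _ ->]].
- by rewrite lie0r mem0v.
- by rewrite lie_linearr memvD ?memvZ ?IHv ?IHw.
case: w => w /= /eqP <- {k}; elim/last_ind: w j => [|w i IH] j u uj.
  by rewrite /= lie0r mem0v.
case: w IH => [_|i0 w IH] /=; first by rewrite addn1; apply: m_pow_lie_gen.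
rewrite foldl_rcons; set v := foldl _ _ _ in IH *.
rewrite lie_leibniz [lie v (lie _ _)]lieC size_rcons addnS; apply: memvB.
  by apply/m_pow_lie_gen/(IH j).
rewrite -addSn; apply: (IH j.+1); exact: m_pow_lie_gen.
Qed.

Lemma fl_bracket_m_pow k x : fl_bracket k x -> cls x \in m_pow k.
Proof.
elim=> [i | i j u v _ IHu _ IHv]; first by rewrite m_pow1; apply: memv_gen.
by rewrite n2_classL; apply: m_pow_lie.
Qed.

(** The grading of n2, in the form used here: m and the spaces [m_pow j] with
    [2 <= j <= t.+1] span n2. *)
Lemma n2_decomp u :
  exists2 v, v \in m & u - v \in (\sum_(2 <= j < t.+2) m_pow j)%VS.
Proof.
elim/n2_ind: u => x; elim: (fl_pow1 x) => [|a j {}x y _ bx _ [v vm uv]].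
  by exists 0; rewrite ?n2_class0 ?subr0 mem0v.
rewrite n2_class_linear; have [jt|tj] := leqP j t.+1; last first.
  exists v => //; have -> : cls x = cls 0.
    by apply/n2_classP; rewrite subr0; apply: fl_bracket_pow bx.
  by rewrite n2_class0 scaler0 add0r.
have [j1|j1] := eqVneq j 1%N.
  exists (a *: cls x + v).
    by rewrite memvD ?memvZ // -m_pow1 -j1 fl_bracket_m_pow.
  by rewrite opprD addrACA subrr add0r.
exists v => //; rewrite -addrA memvD // memvZ //.
have j2 : (2 <= j < t.+2)%N.
  by rewrite ltnS jt andbT ltn_neqAle eq_sym j1 (fl_bracket_gt0 bx).
rewrite (big_cat_nat (n := j)) /=; [|lia|lia].
rewrite big_nat_recl; last by lia.
apply: subvP (fl_bracket_m_pow bx).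
by apply: subv_trans (addvSr _ _); apply: addvSl.
Qed.

Lemma coord1_m_pow_ge2 j u : (1 < j)%N -> u \in m_pow j -> coord1 u = 0.
Proof.
move=> j1; move: u; apply: span_ind => [|a u v IHu IHv|_ /imageP[w _ ->]].
- exact: linear0.
- by rewrite linearP /= IHu IHv scaler0 addr0.
- case: w => w /= /eqP sw; case/lastP: w sw => [|[|i w] k] sw.
  + by rewrite -sw in j1.
  + by rewrite -sw in j1.
  + by rewrite /= foldl_rcons coord1_lie.
Qed.

(** By induction on [n]: the components of the values of [D] on the generators
    in the last space [m_pow j] define a derivation in [Der_ j]. *)
Lemma memv_sum_Der_ n (D : 'End(n2)) : D \in Der n2 ->
  (forall i, D (gen i) \in (\sum_(2 <= j < n) m_pow j)%VS) ->
  D \in (\sum_(2 <= j < n) Der_ j)%VS.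
Proof.
have D0 E : E \in Der n2 -> (forall i, E (gen i) = 0) -> E = 0.
  move=> dE E0; apply: der_ext_uniq => //; first exact: mem0v.
  apply: span_ind => [|a u v IHu IHv|_ /imageP[i _ ->]].
  - by rewrite !linear0.
  - by rewrite !linearP /= IHu IHv.
  - by rewrite zero_lfunE.
elim: n D => [|n IH] D dD Dg.
  rewrite big_geq //; rewrite (D0 D) ?mem0v // => i.
  by have := Dg i; rewrite big_geq // memv0 => /eqP.
have [n_le|n_gt] := leqP n.+1 2.
  rewrite big_geq //; rewrite (D0 D) ?mem0v // => i.
  by have := Dg i; rewrite big_geq // memv0 => /eqP.
have dec i : exists v, v \in m_pow n /\
    D (gen i) - v \in (\sum_(2 <= j < n) m_pow j)%VS.
  have := Dg i; rewrite big_nat_recr //= => /memv_addP[u Su [v Sv ->]].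
  by exists v; rewrite addrK.
have [v vP] := boolp.choice dec.
have [E dE Eg] := der_exists v.
rewrite big_nat_recr //=; apply/memv_addP; exists (D - E).
  apply: IH; first exact: memvB.
  by move=> i; rewrite add_lfunE opp_lfunE Eg; have [] := vP i.
exists E; last by rewrite subrK.
apply/Der_P; split=> //; apply: span_ind => [|a u w IHu IHw|_ /imageP[i _ ->]].
- by rewrite linear0 mem0v.
- by rewrite linearP memvD ?memvZ.
- by rewrite Eg; have [] := vP i.
Qed.

(** A derivation of degree one is determined by its matrix: [Der_ 1] embeds in
    gl_2. *)
Lemma ab_mx_Der1_inj D : D \in Der_ 1 -> ab_mx D = 0 -> D = 0.
Proof.
move=> /Der_P[dD Dm] D0; apply: der_ext_uniq => //; first exact: mem0v.
apply: span_ind => [|a u v IHu IHv|_ /imageP[i _ ->]].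
- by rewrite !linear0.
- by rewrite !linearP /= IHu IHv.
have Dim : D (gen i) \in m by rewrite -m_pow1 Dm // memv_gen.
rewrite zero_lfunE (memv_m_coord1 Dim) -row_ab_mx D0 big1 // => j _.
by rewrite !mxE scale0r.
Qed.

Lemma ab_mx_sum_Der_ D : D \in (\sum_(2 <= j < t.+2) Der_ j)%VS -> ab_mx D = 0.
Proof.
suff sub : (\sum_(2 <= j < t.+2) Der_ j <= lker (linfun (@ab_mx K t)))%VS.
  by move/(subvP sub); rewrite memv_ker lfunE => /eqP.
rewrite big_seq; elim/big_ind: _ => [|U V sU sV|j].
- exact: sub0v.
- by rewrite subv_add sU.
rewrite mem_index_iota => /andP[j2 _]; apply/subvP => E /Der_P[_ Em].
rewrite memv_ker lfunE; apply/eqP/row_matrixP => i.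
by rewrite row_ab_mx row0 (coord1_m_pow_ge2 j2) // Em // memv_gen.
Qed.

Lemma Der1_cap_sum : (Der_ 1 :&: \sum_(2 <= j < t.+2) Der_ j)%VS = 0%VS.
Proof.
apply/eqP; rewrite -subv0; apply/subvP => D; rewrite memv_cap memv0.
by case/andP=> D1 /ab_mx_sum_Der_ D0; apply/eqP/ab_mx_Der1_inj.
Qed.

Lemma memv_Der1_add_sum D : D \in Der n2 ->
  D \in (Der_ 1 + \sum_(2 <= j < t.+2) Der_ j)%VS.
Proof.
move=> dD.
have dec i : exists v, v \in m /\
    D (gen i) - v \in (\sum_(2 <= j < t.+2) m_pow j)%VS.
  by have [v] := n2_decomp (D (gen i)); exists v.
have [v vP] := boolp.choice dec.
have [E dE Eg] := der_exists v.
apply/memv_addP; exists E.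
  apply/Der_P; split=> //; apply: span_ind => [|a u w IHu IHw|_ /imageP[i _ ->]].
  - by rewrite linear0 mem0v.
  - by rewrite linearP memvD ?memvZ.
  - by rewrite Eg m_pow1; have [] := vP i.
exists (D - E); last by rewrite addrC subrK.
apply: memv_sum_Der_; first exact: memvB.
by move=> i; rewrite add_lfunE opp_lfunE Eg; have [] := vP i.
Qed.

Lemma proj_Der1_mem D : proj_Der1 K t.+1 D \in Der_ 1.
Proof. exact: memv_pi. Qed.

(** The projection onto [Der_ 1] does not change the action on the
    abelianization, so it amounts to taking the matrix [ab_mx]. *)
Lemma ab_mx_proj_Der1 D : D \in Der n2 -> ab_mx (proj_Der1 K t.+1 D) = ab_mx D.
Proof.
move=> /memv_Der1_add_sum /(daddv_pi_add Der1_cap_sum) ED.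
rewrite -[in RHS]ED linearD /= (@ab_mx_sum_Der_ (daddv_pi _ (Der_ 1) D)) ?addr0 //.
exact: memv_pi.
Qed.

Lemma id2_Der1 : id2 K t.+1 \in Der_ 1.
Proof.
have [dI idE] := der_extP (linfun (@vsval K n2 m)).
apply/Der_P; split=> // u um; rewrite -[u](vsprojK um) idE lfunE /= m_pow1.
exact: subvsP.
Qed.

Lemma ab_mx_id2 : ab_mx (id2 K t.+1) = 1%:M.
Proof.
have [dI idE] := der_extP (linfun (@vsval K n2 m)).
apply/row_matrixP => i.
by rewrite row_ab_mx -{1}[gen i](vsprojK (memv_gen K t.+1 i)) idE lfunE /= vsprojK
  ?memv_gen // coord1_gen // row1.
Qed.

Lemma Der1_lie D E : D \in Der_ 1 -> E \in Der_ 1 -> lie D E \in Der_ 1.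
Proof.
move=> /Der_P[/DerP dD Dm] /Der_P[/DerP dE Em]; rewrite m_pow1 in Dm Em.
apply/Der_P; split; last first.
  by move=> u um; rewrite commutatorE m_pow1; apply: memvB; [apply/Dm/Em | apply/Em/Dm].
exact/DerP/derivation_lie.
Qed.

Lemma Der1_lie_eq0 D E : D \in Der_ 1 -> E \in Der_ 1 ->
  lie D E = 0 <-> ab_mx D *m ab_mx E = ab_mx E *m ab_mx D.
Proof.
move=> D1 E1; have [/DerP dD _] := Der_P _ _ D1; have [/DerP dE _] := Der_P _ _ E1.
have H := ab_mx_lie dD dE; split=> [DE0 | DE].
  apply/esym/eqP; rewrite -subr_eq0 -H DE0; apply/eqP/linear0.
by apply: (ab_mx_Der1_inj (Der1_lie D1 E1)); rewrite H DE subrr.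
Qed.

(** The centralizer in gl_2 of a non-scalar matrix, read in [Der_ 1]. *)
Lemma centralizer_Der1 D : D \in Der_ 1 -> D \notin <[id2 K t.+1]>%VS ->
  (centralizer (Der_ 1) D <= <[id2 K t.+1]> + <[D]>)%VS.
Proof.
move=> D1 Did.
have nsD : ~~ is_scalar_mx (ab_mx D).
  apply: contra Did => /is_scalar_mxP[c Dc]; apply/vlineP; exists c.
  apply/eqP; rewrite -subr_eq0; apply/eqP; apply: ab_mx_Der1_inj.
    by rewrite memvB // memvZ // id2_Der1.
  by rewrite linearB linearZ /= ab_mx_id2 Dc scalemx1 subrr.
apply/subvP => E /centralizerP[E1 /(Der1_lie_eq0 D1 E1) DE].
have [a [b Eab]] := comm_mx2_span nsD DE.
suff -> : E = a *: id2 K t.+1 + b *: D by rewrite memv_add ?memvZ ?memv_line.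
apply/eqP; rewrite -subr_eq0; apply/eqP; apply: ab_mx_Der1_inj.
  by rewrite memvB // memvD // memvZ // id2_Der1.
by rewrite linearB linearD !linearZ /= ab_mx_id2 Eab scalemx1 subrr.
Qed.

Lemma dim_line_add (D : 'End(n2)) : (\dim (<[id2 K t.+1]> + <[D]>) <= 2)%N.
Proof.
apply: leq_trans (dimv_add_leqif _ _) _; rewrite !dim_vline.
by case: (_ != 0); case: (_ != 0).
Qed.

End Grading.

(** * A filtration raised by nilpotent actions *)

Section Weights.
Variables (K : fieldType) (t : nat).

Notation n2 := (n2 K t.+1).
Notation gen := (n2_gen K t.+1).
Notation cls := (@n2_class K t.+1).

(* A family of derivations all of whose pairwise products vanish on the
   abelianization. *)
Variable P : 'End(n2) -> Prop.
Hypothesis P_der : forall D, P D -> is_derivation D.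
Hypothesis P_sqr0 : forall D E, P D -> P E -> ab_mx D *m ab_mx E = 0.

(** A weight filtration of n2 that every derivation of the family raises by one.
    On the plane n2 / [n2, n2], the common kernel of the family contains all its
    images. All elements have weight at least 2, those whose class lies in the
    common kernel have weight at least 3, and weights add up under brackets. An
    element of weight 3 is mapped into [n2, n2], whose elements have weight at
    least 2 + 2 = 4; starting from the weights 1 and 2 instead, the image would
    only get weight 2. *)
Inductive wt : nat -> n2 -> Prop :=
| wt_full u : wt 2 u
| wt_ker u : (forall D, P D -> coord1 (D u) = 0) -> wt 3 u
| wt_lie i j u v : wt i u -> wt j v -> wt (i + j) (lie u v)
| wt_0 i : wt i 0
| wt_lin i a u v : wt i u -> wt i v -> wt i (a *: u + v).

Lemma wt4 u : coord1 u = 0 -> wt 4 u.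
Proof.
move=> u0; suff : wt 4 (u - \sum_i coord1 u 0 i *: gen i).
  by rewrite u0 big1 ?subr0 // => i _; rewrite mxE scale0r.
elim/n2_gen_ind: u {u0} => [i || a u v IHu IHv | u v _ _].
- rewrite -memv_m_coord1 ?memv_gen // subrr; exact: wt_0.
- rewrite linear0 big1 ?subr0; first exact: wt_0.
  by move=> i _; rewrite mxE scale0r.
- set s := \sum_i _; suff -> : a *: u + v - s =
      a *: (u - \sum_i coord1 u 0 i *: gen i) + (v - \sum_i coord1 v 0 i *: gen i).
    exact: wt_lin.
  rewrite scalerBr addrACA -opprD; congr (_ - _); rewrite /s linearP /=.
  rewrite scaler_sumr -big_split /=; apply: eq_bigr => i _.
  by rewrite !mxE scalerDl scalerA.
- rewrite coord1_lie big1 ?subr0; first exact: (wt_lie (wt_full u) (wt_full v)).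
  by move=> i _; rewrite mxE scale0r.
Qed.

Lemma wt_der D i u : P D -> wt i u -> wt i.+1 (D u).
Proof.
move=> PD; elim=> {i u} [u | u u0 | i j u v wu IHu wv IHv | i | i a u v _ IHu _ IHv].
- apply: wt_ker => E PE.
  by rewrite (coord1_der _ (P_der PE)) (coord1_der _ (P_der PD)) -mulmxA P_sqr0 ?mulmx0.
- exact/wt4/u0.
- rewrite P_der // -[X in wt X _]/((i + j).+1) -[lie (D u) v]scale1r.
  apply: wt_lin; first by rewrite -addSn; apply: wt_lie.
  by rewrite -addnS; apply: wt_lie.
- by rewrite linear0; apply: wt_0.
- by rewrite linearP /=; apply: wt_lin.
Qed.

(** Each factor of a bracket contributes at most 3 to the weight, so an element
    of weight [i] is a sum of brackets of length at least [i / 3]. *)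
Lemma wt_fl_pow i k u : wt i u -> (3 * k <= i.+2)%N ->
  exists2 x, fl_pow k x & u = cls x.
Proof.
move=> wu; elim: wu k => {i u} [u | u _ | i j u v _ IHu _ IHv | i | i a u v _ IHu _ IHv] k ki.
- exists (repr u); last by rewrite n2_reprK.
  by apply: fl_powW (fl_pow1 _); lia.
- exists (repr u); last by rewrite n2_reprK.
  by apply: fl_powW (fl_pow1 _); lia.
- have [|x px ->] := IHu (i.+2 %/ 3)%N; first by lia.
  have [|y py ->] := IHv (j.+2 %/ 3)%N; first by lia.
  exists (lie x y); last by rewrite n2_classL.
  by apply: fl_powW (fl_pow_lie px py); lia.
- by exists 0; [apply: fl_pow0 | rewrite n2_class0].
- have [x px ->] := IHu k ki; have [y py ->] := IHv k ki.
  by exists (a *: x + y); [apply: fl_powP | rewrite n2_class_linear].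
Qed.

Lemma wt_eq0 i u : wt i u -> (3 * t.+1 < i)%N -> u = 0.
Proof.
move=> wu ti; have [|x px ->] := wt_fl_pow (k := t.+2) wu; first by lia.
by rewrite -[0](n2_class0 K t.+1); apply/n2_classP; rewrite subr0.
Qed.

End Weights.

(** * Solvable Lie algebras with free nilpotent nilradical *)

Section SolvableExtension.
Variables (K : fieldType) (t : nat) (r : vectLieType K).
Notation n2 := (n2 K t.+1).
Variable iota : 'Hom(n2, r).
Notation N := (limg iota).
Notation D_ := (ad_n2 iota).
Hypotheses (iota_lie : lie_morph iota) (iota_inj : lker iota = 0%VS).
Hypothesis N_nil : is_nilradical N.

Let iotaI : injective iota.
Proof. by apply/lker0P; rewrite iota_inj. Qed.

Let N_ideal : is_ideal N.
Proof. by case: N_nil. Qed.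

Let D_E a u : iota (D_ a u) = lie a (iota u).
Proof. exact: ad_n2E. Qed.

Lemma ad_n2_der a : is_derivation (D_ a).
Proof.
move=> u v; apply: iotaI.
by rewrite linearD /= !iota_lie !D_E iota_lie lie_leibniz.
Qed.

Lemma ad_n2_mem_Der a : D_ a \in Der n2.
Proof. exact/DerP/ad_n2_der. Qed.

Lemma ad_n2_lie a b : D_ (lie a b) = lie (D_ a) (D_ b).
Proof.
apply/lfunP => u; apply: iotaI; rewrite commutatorE linearB /= !D_E.
by rewrite [lie a (lie b _)]lie_leibniz addrK.
Qed.

Lemma ad_n2_iota u : D_ (iota u) = ad n2 u.
Proof. by apply/lfunP => v; apply: iotaI; rewrite D_E adE iota_lie. Qed.

(** The matrix of the action of [a] on N / [N, N], reversing products. *)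
Definition rho (a : r) : 'M[K]_2 := ab_mx (D_ a).

Fact rho_is_linear : linear rho.
Proof. by move=> c a b; rewrite /rho !linearP. Qed.
HB.instance Definition _ :=
  GRing.isLinear.Build K r 'M[K]_2 *:%R rho rho_is_linear.

Lemma rho_lie a b : rho (lie a b) = rho b *m rho a - rho a *m rho b.
Proof. by rewrite /rho ad_n2_lie ab_mx_lie //; apply: ad_n2_der. Qed.

Lemma rho_N a : a \in N -> rho a = 0.
Proof. by move=> /memv_imgP[u _ ->]; rewrite /rho ad_n2_iota ab_mx_ad. Qed.

(** An ideal [A] acting on N / [N, N] by matrices with zero products is
    nilpotent, because each bracket with an element of [A] raises the weight in
    N; hence [A] is contained in the nilradical. *)
Lemma nil_action_sub (A : {vspace r}) :
  is_ideal A -> (lie_vs A A <= N)%VS ->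
  {in A &, forall a b, rho a *m rho b = 0} -> (A <= N)%VS.
Proof.
move=> idA AA A0; have [_ _] := N_nil; apply=> //.
pose P (D : 'End(n2)) := exists2 a, a \in A & D = D_ a.
have Pder D : P D -> is_derivation D by move=> [a _ ->]; apply: ad_n2_der.
have P0 D E : P D -> P E -> ab_mx D *m ab_mx E = 0.
  by move=> [a Aa ->] [b Ab ->]; apply: A0.
have lcs k x : x \in lower_central_series A k.+1 ->
    exists2 u, wt P k.+2 u & x = iota u.
  elim: k x => [|k IH] x.
    by move=> /(subvP AA)/memv_imgP[u _ ->]; exists u => //; apply: wt_full.
  move: x; apply: lie_vs_ind => [|c _ _ [u wu ->] [v wv ->]|a x Aa /IH[u wu ->]].
  - by exists 0; [apply: wt_0 | rewrite linear0].
  - by exists (c *: u + v); [apply: wt_lin | rewrite linearP].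
  - by exists (D_ a u); [apply: wt_der => //; exists a | rewrite D_E].
exists (3 * t.+1).+1; apply/eqP; rewrite -subv0; apply/subvP => x /lcs[u wu ->].
by rewrite (wt_eq0 wu) ?linear0 ?mem0v //; lia.
Qed.

Hypothesis two_neq0 : (2%:R : K) != 0.
Hypothesis r_solv : is_solvable (fullv : {vspace r}).

(** Otherwise let [A] be the last term of the derived series that is not
    contained in N. It acts on N / [N, N] by commuting matrices of trace zero.
    If they all have square zero, [nil_action_sub] puts [A] inside N. If one of
    them has a nonzero square, it commutes with the action of every element of r
    by [comm_commutator_mx2]; it is not scalar, so the action of r is commutative, the action of [r, r]
    vanishes, and so does that of [A]. *)
Lemma derived_sub_nilradical : (lie_vs {:r} {:r} <= N)%VS.
Proof.
have exk : exists k, (derived_series (fullv : {vspace r}) k <= N)%VS.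
  by have [k k0] := r_solv; exists k; rewrite k0 sub0v.
case: (ex_minnP exk) => -[|[|k]] kN kmin.
- exact: subv_trans (subvf _) kN.
- exact: kN.
set A := derived_series (fullv : {vspace r}) k.+1 in kN.
have AN : ~~ (A <= N)%VS by apply/negP => /kmin; rewrite ltnn.
have idA : is_ideal A := derived_series_ideal r k.+1.
have trA a : a \in A -> \tr (rho a) = 0.
  move/(subvP (derived_series_sub1 r k)).
  move: a; apply: lie_vs_ind => [|c a b ta tb|a b _ _].
  - by rewrite !linear0.
  - by rewrite linearP /= mxtraceD mxtraceZ ta tb mulr0 addr0.
  - by rewrite rho_lie linearB /= mxtrace_mulC subrr.
have comA : {in A &, forall a b, rho a *m rho b = rho b *m rho a}.
  move=> a b Aa Ab; apply/eqP; rewrite -subr_eq0 -rho_lie rho_N //.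
  exact: subvP kN _ (memv_lie Ab Aa).
have [sq0|] := boolp.pselect {in A, forall a, rho a *m rho a = 0}.
  case/negP: AN; apply: nil_action_sub => // a b Aa Ab.
  exact: commuting_sqr0_mx2 (sq0 a Aa) (sq0 b Ab) (comA a b Aa Ab).
case=> a Aa; apply/eqP; apply: contraT => ra0.
have [d rad] := trace0_mulmx2 (trA a Aa).
have d0 : d != 0.
  by apply: contraNneq ra0 => d0; rewrite rad d0 raddf0.
have nsa := trace0_nonscalar two_neq0 (trA a Aa) rad d0.
have cen x : rho a *m rho x = rho x *m rho a.
  apply: (comm_commutator_mx2 two_neq0 rad d0); rewrite -rho_lie.
  apply: comA => //; exact: (lie_vsP _ _ _ idA) (memvf x) Aa.
have : rho a = 0.
  have := subvP (derived_series_sub1 r k) _ Aa.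
  move: (a); apply: lie_vs_ind => [|c x y rx ry|x y _ _].
  - exact: linear0.
  - by rewrite linearP /= rx ry scaler0 addr0.
  - by rewrite rho_lie (comm_mx2_trans nsa (cen y) (cen x)) subrr.
by move=> ra; rewrite ra mul0mx eqxx in ra0.
Qed.

(** As [r, r] is contained in N, the sum of N and the line of [a] is an ideal. *)
Lemma rho_sqr0_mem_N a : rho a *m rho a = 0 -> a \in N.
Proof.
move=> a0; suff : (<[a]> + N <= N)%VS.
  by rewrite subv_add -memvE => /andP[].
apply: nil_action_sub.
- apply/lie_vsP => x y _ _; apply: subvP (addvSr _ _) _ _.
  by apply: subvP derived_sub_nilradical _ _; apply: memv_lie; apply: memvf.
- apply: subv_trans derived_sub_nilradical; apply/lie_vsP => x y _ _.
  by apply: memv_lie; apply: memvf.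
(* N acts trivially, so this ideal acts through multiples of [rho a]. *)
- have rhoaN b : b \in (<[a]> + N)%VS -> exists c, rho b = c *: rho a.
    move=> /memv_addP[_ /vlineP[c ->] [v vN ->]]; exists c.
    by rewrite linearD linearZ /= (rho_N vN) addr0.
  move=> b c /rhoaN[x ->] /rhoaN[y ->].
  by rewrite -scalemxAl -scalemxAr a0 !scaler0.
Qed.

Lemma rho_comm a b : rho a *m rho b = rho b *m rho a.
Proof.
apply/eqP; rewrite -subr_eq0 -rho_lie rho_N //.
by apply: subvP derived_sub_nilradical _ _; apply: memv_lie; apply: memvf.
Qed.

Lemma ad_bracket_inner x y : exists b, lie (D_ x) (D_ y) = ad n2 b.
Proof.
have /memv_imgP[b _ xyb] : lie x y \in N.
  by apply: subvP derived_sub_nilradical _ _; apply: memv_lie; apply: memvf.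
by exists b; rewrite -ad_n2_lie xyb ad_n2_iota.
Qed.

Section Complement.
Variable T : {vspace r}.
Hypothesis capNT : (N :&: T)%VS = 0%VS.

(* The derivations of n2 induced by T, and their components of degree one. *)
Let adT := (D_ @: T)%VS.
Let p1T := (proj_Der1 K t.+1 @: adT)%VS.

Lemma T_rho_sqr0 a : a \in T -> rho a *m rho a = 0 -> a = 0.
Proof.
move=> Ta /rho_sqr0_mem_N Na.
by apply/eqP; rewrite -memv0 -capNT memv_cap Na.
Qed.

Lemma p1TP D : D \in p1T -> exists2 a, a \in T & D = proj_Der1 K t.+1 (D_ a).
Proof.
by move=> /memv_imgP[_ /memv_imgP[a Ta ->] ->]; exists a.
Qed.

Lemma dim_p1T : \dim p1T = \dim T.
Proof.
have inj a : a \in T -> proj_Der1 K t.+1 (D_ a) = 0 -> a = 0.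
  move=> Ta Da; apply: T_rho_sqr0 => //.
  suff -> : rho a = 0 by rewrite mul0mx.
  by rewrite /rho -ab_mx_proj_Der1 ?ad_n2_mem_Der // Da linear0.
rewrite /p1T limg_dim_eq; [rewrite /adT limg_dim_eq //|].
  apply/eqP; rewrite -subv0; apply/subvP => a; rewrite memv_cap memv_ker memv0.
  by case/andP=> Ta /eqP Da; rewrite (inj a) // Da linear0.
apply/eqP; rewrite -subv0; apply/subvP => D; rewrite memv_cap memv_ker memv0.
by case/andP=> /memv_imgP[a Ta ->] /eqP Da; rewrite (inj a) // linear0.
Qed.

Lemma p1T_sub : (p1T <= Der_ K t.+1 1)%VS.
Proof. by apply/subvP => D /memv_imgP[E _ ->]; apply: proj_Der1_mem. Qed.

Lemma p1T_comm D E : D \in p1T -> E \in p1T -> lie D E = 0.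
Proof.
move=> pD pE; apply/Der1_lie_eq0; try exact: subvP p1T_sub _ _.
have [a Ta ->] := p1TP pD; have [b Tb ->] := p1TP pE.
by rewrite !ab_mx_proj_Der1 ?ad_n2_mem_Der //; apply: rho_comm.
Qed.

Lemma p1T_abelian : is_abelian p1T.
Proof.
apply/eqP; rewrite -subv0; apply/lie_vsP => D E pD pE.
by rewrite p1T_comm // mem0v.
Qed.

Lemma p1T_sub_centralizer D : D \in p1T ->
  (p1T <= centralizer (Der_ K t.+1 1) D)%VS.
Proof.
move=> pD; apply/subvP => E pE; apply/centralizerP; split.
  exact: subvP p1T_sub _ pE.
exact: p1T_comm.
Qed.

Lemma dim_p1T_le2 : (\dim p1T <= 2)%N.
Proof.
have [p1id|/subvPn[D pD Did]] := boolP (p1T <= <[id2 K t.+1]>)%VS.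
  apply: leq_trans (dim_line_add 0); apply: dimvS.
  exact: subv_trans p1id (addvSl _ _).
apply: leq_trans (dim_line_add D); apply: dimvS.
apply: subv_trans (p1T_sub_centralizer pD) _.
by apply: centralizer_Der1 => //; apply: subvP p1T_sub _ _.
Qed.

Lemma p1T_centralizer : \dim T = 2%N -> exists D,
  [/\ D \in Der_ K t.+1 1, D \notin <[id2 K t.+1]>%VS
    & p1T = centralizer (Der_ K t.+1 1) D].
Proof.
rewrite -dim_p1T => dimT.
have [p1id|/subvPn[D pD Did]] := boolP (p1T <= <[id2 K t.+1]>)%VS.
  by have := dimvS p1id; rewrite dimT dim_vline; case: (_ != 0).
have D1 : D \in Der_ K t.+1 1 := subvP p1T_sub _ pD.
exists D; split=> //; apply/eqP; rewrite eqEdim p1T_sub_centralizer //= dimT.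
exact: leq_trans (dimvS (centralizer_Der1 D1 Did)) (dim_line_add D).
Qed.

Lemma adT_nilpotent D : D \in adT -> nilpotent_endo D -> D = 0.
Proof.
move=> /memv_imgP[a Ta ->] Dnil; rewrite (T_rho_sqr0 Ta) ?linear0 //.
exact: ab_mx_nilpotent (ad_n2_der a) Dnil.
Qed.

End Complement.

End SolvableExtension.

Theorem lemma3p1 (R : realType) (t : nat) (ht : (1 <= t)%N)
    (r : vectLieType R[i]) (hsol : is_solvable (fullv : {vspace r}))
    (iota : 'Hom(n2 R[i] t, r))
    (hmor : lie_morph iota) (hinj : lker iota = 0%VS)
    (hnil : is_nilradical (limg iota)) :
  (exists T : {vspace r},
      (limg iota + T)%VS = fullv /\ (limg iota :&: T)%VS = 0%VS) /\
  forall T : {vspace r},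
    (limg iota + T)%VS = fullv -> (limg iota :&: T)%VS = 0%VS ->
    let adT := (ad_n2 iota @: T)%VS in
    let p1T := (proj_Der1 R[i] t @: adT)%VS in
    [/\ \dim T = \dim p1T,
        (p1T <= Der_ R[i] t 1)%VS /\ is_subalgebra p1T,
        is_abelian p1T,
        (\dim p1T <= 2)%N
      & forall D, D \in adT -> nilpotent_endo D -> D = 0] /\
    (\dim T = 2%N -> forall x y : r, T = (<[x]> + <[y]>)%VS ->
       (exists d, [/\ d \in Der_ R[i] t 1,
                      d \notin (<[id2 R[i] t]>)%VS
                    & p1T = centralizer (Der_ R[i] t 1) d]) /\
       (exists b : n2 R[i] t,
          lie (ad_n2 iota x) (ad_n2 iota y) = ad (n2 R[i] t) b)).
Proof.
case: t ht iota hmor hinj hnil => // t _ iota hmor hinj hnil.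
have two_neq0 : (2%:R : R[i]) != 0 by rewrite Num.Theory.pnatr_eq0.
split; first by exists ((limg iota)^C)%VS; rewrite addv_complf capv_compl.
move=> T _ capNT adT p1T; split.
  split.
  - by rewrite (dim_p1T hmor hinj hnil two_neq0 hsol capNT).
  - split; first exact: p1T_sub.
    by rewrite /is_subalgebra (p1T_abelian hmor hinj hnil two_neq0 hsol) sub0v.
  - exact: p1T_abelian hmor hinj hnil two_neq0 hsol T.
  - exact: dim_p1T_le2 hmor hinj hnil two_neq0 hsol T.
  - exact: adT_nilpotent hmor hinj hnil two_neq0 hsol T capNT.
move=> dimT x y _; split.
  exact: p1T_centralizer hmor hinj hnil two_neq0 hsol T capNT dimT.
exact: ad_bracket_inner hmor hinj hnil two_neq0 hsol x y.
Qed.
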